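(* Let $F,G\in C^1([0,+\infty))$ and $K\in C([0,+\infty))$ satisfy (A0), (A1), (A2) (see context), and let $\rho\in(0,+\infty)$. Then there exists a solution $(\lambda,u)\in(0,+\infty)\times C^2(\mathbb{R})$ to $$-u''+\lambda G'(u)=F'(u)\ \text{ in }\mathbb{R},\qquad \int_{\mathbb{R}}K(u)\,\mathrm{d}x=\rho,$$ in each of the following cases: (i) $m_0=0$, $L_0<\ell_\infty$, and $\rho\in\left(\frac{\pi}{\sqrt{2\ell_\infty}},\frac{\pi}{\sqrt{2L_0}}\right)$; (ii) $m_0=0$, $L_\infty<\ell_0$, and $\rho\in\left(\frac{\pi}{\sqrt{2\ell_0}},\frac{\pi}{\sqrt{2L_\infty}}\right)$; (iii) $m_0>0$, $I_F>\frac{\pi}{\sqrt{2\ell_\infty}}$, and $\rho\in\left(\frac{\pi}{\sqrt{2\ell_\infty}},I_F\right)$; (iv) $m_0>0$, $F'(m_0)\neq0$, $I_F<\frac{\pi}{\sqrt{2L_\infty}}$, and $\rho\in\left(I_F,\frac{\pi}{\sqrt{2L_\infty}}\right)$. Furthermore, $u'\in L^2(\mathbb{R})$, $u$ is non-negative and even, and $\lim_{|x|\to+\infty}u(x)=0$.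
   Context: Assumptions. (A0) $F,G\in C^1([0,+\infty))$, $F(0)=G(0)=F'(0)=G'(0)=0$, $G'(s)>0$ for all $s>0$, $\lim_{s\to0^+}\frac{F(s)}{G(s)}=0$, and $\lim_{s\to+\infty}\frac{F(s)}{G(s)}=+\infty$. (A1) For all $s>0$ such that $F(s)>0$ there holds $Z(s)>0$, where $Z:=\left(\frac{F}{G}\right)'$ on $(0,+\infty)$. (A2) $K\in C([0,+\infty))$, $K(0)=0$, $K(s)>0$ for all $s>0$, $s\mapsto\frac{K(s)}{\sqrt{G(s)}}$ is integrable in a right-hand neighbourhood of $0$, and $\int_0^{+\infty}\frac{K(s)}{\sqrt{G(s)}}\,\mathrm{d}s=+\infty$. Definitions. For $t>0$, $\Phi(t):=\left(\int_0^t\frac{K(s)}{\sqrt{G(s)}}\,\mathrm{d}s\right)^2$; $m_0:=\max\{t\ge0:\ F\le0\text{ on }[0,t]\}$; if $m_0>0$, $I_F:=\sqrt2\int_0^{m_0}\frac{K(s)}{\sqrt{|F(s)|}}\,\mathrm{d}s\in(0,+\infty]$ (the integrand being $+\infty$ where $s>0$ and $F(s)=0$). Moreover $$L_0:=\limsup_{s\to0^+}\frac{Z(s)}{\Phi'(s)},\quad \ell_0:=\liminf_{s\to0^+}\frac{Z(s)}{\Phi'(s)},\quad L_\infty:=\limsup_{s\to+\infty}\frac{Z(s)}{\Phi'(s)},\quad \ell_\infty:=\liminf_{s\to+\infty}\frac{Z(s)}{\Phi'(s)}.$$ Conventions: $\frac10=+\infty$ and $\frac1{+\infty}=0$ (so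 $\frac{\pi}{\sqrt{2\cdot 0}}=+\infty$ and $\frac{\pi}{\sqrt{2\cdot(+\infty)}}=0$). *)

(* Defs.v *)
From mathcomp Require Import all_boot all_order all_algebra.
From mathcomp Require Import all_classical all_reals all_analysis.

Set Implicit Arguments.
Unset Strict Implicit.
Unset Printing Implicit Defensive.

Import Order.TTheory GRing.Theory Num.Theory.
Import numFieldNormedType.Exports.

Local Open Scope classical_set_scope.
Local Open Scope ring_scope.

(* A function on the half-line [0, +oo) is encoded by a total function on R
   whose values at negative arguments are never used. Accordingly, limits of
   difference quotients are taken within [0, +oo): this is the usual derivative
   at x > 0 and the right derivative at x = 0. *)
Definition hquot (R : realType) (f : R -> R) (x : R) : R -> R :=
  fun y => (f y - f x) / (y - x).

Definition hderivable (R : realType) (f : R -> R) (x : R) : Prop :=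
  cvg (hquot f x y @[y --> within `[0, +oo[ x^']).

Definition hderiv (R : realType) (f : R -> R) (x : R) : R :=
  lim (hquot f x y @[y --> within `[0, +oo[ x^']).

Definition hC1 (R : realType) (f : R -> R) : Prop :=
  (forall x, 0 <= x -> hderivable f x) /\
  {within `[0, +oo[, continuous (hderiv f)}.

Definition Zfun (R : realType) (F G : R -> R) : R -> R :=
  derive1 (fun s => F s / G s).

Definition weight (R : realType) (G K : R -> R) (s : R) : R :=
  K s / Num.sqrt (G s).

Definition Phi (R : realType) (G K : R -> R) (t : R) : R :=
  (\int[lebesgue_measure]_(s in `]0, t]) weight G K s) ^+ 2.

Definition assumptionA0 (R : realType) (F G : R -> R) : Prop :=
  (hC1 F /\ hC1 G) /\
  [/\ F 0 = 0, G 0 = 0, hderiv F 0 = 0 & hderiv G 0 = 0] /\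
  (forall s, 0 < s -> 0 < hderiv G s) /\
  F s / G s @[s --> 0^'+] --> 0 /\
  F s / G s @[s --> +oo] --> +oo.

Definition assumptionA1 (R : realType) (F G : R -> R) : Prop :=
  forall s, 0 < s -> 0 < F s -> 0 < Zfun F G s.

Definition assumptionA2 (R : realType) (G K : R -> R) : Prop :=
  {within `[0, +oo[, continuous K} /\
  K 0 = 0 /\
  (forall s, 0 < s -> 0 < K s) /\
  (exists2 d : R, 0 < d &
    lebesgue_measure.-integrable `]0, d[ (EFin \o weight G K)) /\
  (\int[lebesgue_measure]_(s in `]0%R, +oo[) (weight G K s)%:E = +oo)%E.

(* The maximum of {t >= 0 | F <= 0 on [0, t]} (it exists under assumptionA0;
   the default value 0 is irrelevant). *)
Definition m0 (R : realType) (F : R -> R) : R :=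
  let A := [set t | 0 <= t /\ forall s, 0 <= s <= t -> F s <= 0] in
  xget 0 [set m | A m /\ ubound A m].

(* The division is that of \bar R, where 0^-1 = +oo: the integrand is +oo at
   each s > 0 with F s = 0. *)
Definition IF (R : realType) (F K : R -> R) : \bar R :=
  ((Num.sqrt 2)%:E *
    \int[lebesgue_measure]_(s in `]0%R, m0 F])
      ((K s)%:E / (Num.sqrt `|F s|)%:E))%E.

Definition ratio (R : realType) (F G K : R -> R) (s : R) : \bar R :=
  (Zfun F G s / derive1 (Phi G K) s)%:E.

Definition Lsup0 (R : realType) (F G K : R -> R) : \bar R :=
  limf_esup (ratio F G K) 0^'+.
Definition linf0 (R : realType) (F G K : R -> R) : \bar R :=
  limf_einf (ratio F G K) 0^'+.
Definition Lsupy (R : realType) (F G K : R -> R) : \bar R :=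
  limf_esup (ratio F G K) (pinfty_nbhs R).
Definition linfy (R : realType) (F G K : R -> R) : \bar R :=
  limf_einf (ratio F G K) (pinfty_nbhs R).

(* pi / sqrt (2 L), with 1 / 0 = +oo and 1 / +oo = 0 as in \bar R. *)
Definition pi_sqrt2 (R : realType) (L : \bar R) : \bar R :=
  (pi%:E / sqrte (2%:E * L))%E.

Definition C2 (R : realType) (u : R -> R) : Prop :=
  [/\ forall x, derivable u x 1,
      forall x, derivable (derive1 u) x 1
    & continuous (derive1n 2 u)].

Definition admissible_mass (R : realType) (F G K : R -> R) (rho : R) : Prop :=
  [\/ [/\ m0 F = 0, (Lsup0 F G K < linfy F G K)%E
        & (pi_sqrt2 (linfy F G K) < rho%:E < pi_sqrt2 (Lsup0 F G K))%E],
      [/\ m0 F = 0, (Lsupy F G K < linf0 F G K)%E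
        & (pi_sqrt2 (linf0 F G K) < rho%:E < pi_sqrt2 (Lsupy F G K))%E],
      [/\ 0 < m0 F, (pi_sqrt2 (linfy F G K) < IF F K)%E
        & (pi_sqrt2 (linfy F G K) < rho%:E < IF F K)%E]
    | [/\ 0 < m0 F, hderiv F (m0 F) <> 0, (IF F K < pi_sqrt2 (Lsupy F G K))%E
        & (IF F K < rho%:E < pi_sqrt2 (Lsupy F G K))%E]].

(* Main.v *)
Require Import Defs.
From mathcomp Require Import all_boot all_order all_algebra.
From mathcomp Require Import all_classical all_reals all_analysis.
From mathcomp Require Import measurable_realfun ring lra.

(* A homoclinic solution with maximum [m] and [u(0) = m] satisfies the first
   integral [u'^2 / 2 = lambda G(u) - F(u)], which forces
   [lambda = h(m)] for [h = F / G]; it is then the inverse of a time map, extended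
   by [0] if the time map is bounded.  With [w = K / sqrt G] its mass is
   [sqrt 2 * T(m)], where [T(m)] is the integral over [(0, m)] of
   [w(s) / sqrt (h(m) - h(s))], so it remains to solve [T(m) = rho / sqrt 2] by the
   intermediate value theorem on [(m_0, +oo)].  If [W] is the primitive of [w], then
   [Phi = W^2], and a bound [Z <= c Phi'] (or [>=]) compares [T(m)] with the integral
   of [w / sqrt (c (W(m)^2 - W^2))], an arcsine whose value is [pi / (2 sqrt c)].
   This gives the behaviour of [T] at [+oo] and, if [m_0 = 0], at [0]; as [m]
   decreases to [m_0 > 0], monotone convergence gives [sqrt 2 * T(m) -> I_F]. *)

Import Order.TTheory GRing.Theory Num.Theory.
Import numFieldNormedType.Exports.

Set Implicit Arguments.
Unset Strict Implicit.
Unset Printing Implicit Defensive.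

Local Open Scope classical_set_scope.
Local Open Scope ring_scope.

Local Notation mu := lebesgue_measure.

(** * Derivatives and integrals on open intervals *)

(** The comparison function [Phi] is singled out by an exact case: if [h = c W^2], the substitution
    [r = W(s) / W(m)] removes both [w] and [m] from the integral, so [T] is constant and every
    amplitude has the same mass. The four limits measure how far [h] departs from this case at
    either end of the range of amplitudes. Since [F'] and [G'] are merely continuous, there is no
    uniqueness for the Cauchy problem and the solution may have compact support. The profile is
    therefore obtained by inverting a monotone function, and the equation needs separate arguments
    at the maximum and at the edge of the support. The main analytic obstacle is that the
    singularity of the integrand of [T(m)] sits at the moving endpoint [s = m]. Each estimate cuts
    the integral at an interior point: left of it the integrand is dominated by a multiple of [w],
    right of it a positive lower bound on [Z] gives a contribution of order [sqrt (m - a)]. In case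
    (iv) this last bound must persist down to [m_0], which is what [F'(m_0) <> 0] provides; in case
    (iii) the right-hand piece is simply dropped. *)

Lemma is_derive_quotP (R : realType) (f : R -> R) (x l : R) :
  h^-1 *: (f (h + x) - f x) @[h --> 0^'] --> l -> is_derive x 1 f l.
Proof.
move=> fl.
have E : (fun h : R => h^-1 *: ((f \o shift x) (h *: (1 : R)) - f x)) =
         (fun h => h^-1 *: (f (h + x) - f x)).
  by apply/funext => h /=; rewrite [h *: 1]mulr1.
split; first by apply/cvg_ex; exists l; rewrite E.
by apply/cvg_lim => //; rewrite E.
Qed.

Lemma is_derive_continuous (R : realType) (f : R -> R) (x l : R) :
  is_derive x 1 f l -> {for x, continuous f}.
Proof.
by move=> [df _]; apply/differentiable_continuous/derivable1_diffP.
Qed.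

(** By the mean value theorem the difference quotients at [x] are values of [g] near [x]. It handles
    the two kinds of points where the chain rule breaks down: the maximum at [0] and the edge of the
    support. *)
Lemma is_derive_punctured (R : realType) (f g : R -> R) (x : R) :
  {for x, continuous f} -> {for x, continuous g} ->
  (\forall y \near x^', is_derive (y : R) (1 : R) f (g y)) -> is_derive x 1 f (g x).
Proof.
move=> cf cg dfg; apply: is_derive_quotP; apply/cvgrPdist_le => e e0.
move/cvgrPdist_le : cg => /(_ _ e0) [d1 /= d10 cg].
case: dfg => d2 /= d20 dfg.
exists (Num.min d1 d2) => /=; first by rewrite lt_min d10 d20.
move=> h /=; rewrite sub0r normrN lt_min => /andP[hd1 hd2] h0.
have [h_gt0|h_lt0|/eqP] := ltgtP 0 h; last by rewrite eq_sym (negbTE h0).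
- have xh : x < h + x by lra.
  have dy y : y \in `]x, h + x[ -> is_derive y 1 f (g y).
    rewrite in_itv/= => /andP[xy yh]; apply: dfg; last by rewrite gt_eqF.
    by rewrite /= distrC gtr0_norm ?subr_gt0// (lt_trans _ hd2)// gtr0_norm; lra.
  have cf' : {within `[x, h + x], continuous f}.
    apply/continuous_within_itvP => //; split.
    + by move=> y /dy /is_derive_continuous.
    + exact: cvg_at_right_filter.
    + apply/cvg_at_left_filter/(@is_derive_continuous _ _ _ (g (h + x))).
      apply: dfg; last by rewrite gt_eqF.
      by rewrite /= opprD addrCA subrr addr0 normrN.
  have [y] := MVT xh dy cf'; rewrite in_itv/= => /andP[xy yh] ->.
  rewrite addrK [_ *: _]mulrC mulfK//; apply: cg.
  by rewrite /= distrC gtr0_norm ?subr_gt0// (lt_trans _ hd1)// gtr0_norm; lra.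
- have xh : h + x < x by lra.
  have dy y : y \in `]h + x, x[ -> is_derive y 1 f (g y).
    rewrite in_itv/= => /andP[xy yh]; apply: dfg; last by rewrite lt_eqF.
    by rewrite /= gtr0_norm ?subr_gt0// (lt_trans _ hd2)// ltr0_norm; lra.
  have cf' : {within `[h + x, x], continuous f}.
    apply/continuous_within_itvP => //; split.
    + by move=> y /dy /is_derive_continuous.
    + apply/cvg_at_right_filter/(@is_derive_continuous _ _ _ (g (h + x))).
      apply: dfg; last by rewrite lt_eqF.
      by rewrite /= opprD addrCA subrr addr0 normrN.
    + exact: cvg_at_left_filter.
  have [y] := MVT xh dy cf'; rewrite in_itv/= => /andP[xy yh] E.
  have -> : f (h + x) - f x = g y * h by rewrite -opprB E; ring.
  rewrite [_ *: _]mulrC mulfK//; apply: cg.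
  by rewrite /= gtr0_norm ?subr_gt0// (lt_trans _ hd1)// ltr0_norm; lra.
Qed.

Lemma continuous_div_sqrt (R : realType) (w g : R -> R) (s : R) :
  {for s, continuous w} -> {for s, continuous g} -> 0 < g s ->
  {for s, continuous (fun s => w s / Num.sqrt (g s))}.
Proof.
move=> cw cg g0.
have cS : {for s, continuous (fun s => Num.sqrt (g s))}.
  exact: (continuous_comp cg (@sqrt_continuous R _)).
have cV : {for s, continuous (fun s => (Num.sqrt (g s))^-1)}.
  by apply: cvgV cS; rewrite gt_eqF// sqrtr_gt0.
exact: cvgM cw cV.
Qed.

Lemma in_continuous_measurable_oo (R : realType) (f : R -> R) (a b : R) :
  {in `]a, b[, continuous f} -> measurable_fun `]a, b[ f.
Proof.
move=> cf; apply: open_continuous_measurable_fun => //.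
by move=> x; rewrite inE => xab; exact: cf.
Qed.

Lemma integral_itv_seg (R : realType) (f : R -> R) (a b : R) :
  measurable_fun `]a, b[ f ->
  (\int[mu]_(x in `[a, b]) (f x)%:E = \int[mu]_(x in `]a, b[) (f x)%:E)%E.
Proof.
by move=> mf; rewrite integral_itv_bndoo//; exact/measurable_EFinP.
Qed.

Lemma integrable_oo_cc (R : realType) (f : R -> R) (a b : R) :
  mu.-integrable `]a, b[ (EFin \o f) -> mu.-integrable `[a, b] (EFin \o f).
Proof.
move=> /integrableP[/measurable_EFinP mf fi]; apply/integrableP; split.
  by apply/measurable_EFinP; apply: measurable_fun_itv_cc mf.
rewrite (integral_itv_bndoo (f := fun x => `|(f x)%:E|%E))//; last first.
  by apply/measurable_EFinP; exact: measurableT_comp.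
Qed.

Lemma integrable_scale (R : realType) (a b r : R) (f : R -> R) :
  mu.-integrable `]a, b[ (EFin \o f) ->
  mu.-integrable `]a, b[ (EFin \o (fun x => r * f x)).
Proof. by move=> fi; exact: (integrableZl _ r fi). Qed.

Lemma le_integral_oo (R : realType) (f g : R -> R) (a b : R) :
  measurable_fun `]a, b[ f -> measurable_fun `]a, b[ g ->
  (forall x, a < x < b -> 0 <= f x <= g x) ->
  (\int[mu]_(x in `]a, b[) (f x)%:E <= \int[mu]_(x in `]a, b[) (g x)%:E)%E.
Proof.
move=> mf mg fg; apply: ge0_le_integral => //.
- by move=> x /=; rewrite in_itv/= => /fg /andP[f0 _]; rewrite lee_fin.
- exact/measurable_EFinP.
- exact/measurable_EFinP.
- by move=> x /=; rewrite in_itv/= => /fg /andP[_ fgx]; rewrite lee_fin.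
Qed.

Lemma integral_oo_scale (R : realType) (f : R -> R) (a b r : R) :
  measurable_fun `]a, b[ f -> (forall x, a < x < b -> 0 <= f x) -> 0 <= r ->
  (\int[mu]_(x in `]a, b[) (r * f x)%:E = r%:E * \int[mu]_(x in `]a, b[) (f x)%:E)%E.
Proof.
move=> mf f0 r0; under eq_integral do rewrite EFinM.
rewrite ge0_integralZl//.
by apply/measurable_EFinP.
Qed.

Lemma integral_oo_split (R : realType) (f : R -> R) (a c b : R) :
  a < c < b -> measurable_fun `]a, b[ f -> (forall x, a < x < b -> 0 <= f x) ->
  (\int[mu]_(x in `]a, b[) (f x)%:E =
   \int[mu]_(x in `]a, c[) (f x)%:E + \int[mu]_(x in `]c, b[) (f x)%:E)%E.
Proof.
move=> /andP[ac cb] mf f0.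
have subl : `]a, c] `<=` `]a, b[ by apply: subset_itvl; rewrite bnd_simp.
have subo : `]a, c[ `<=` `]a, b[ by apply: subset_itvl; rewrite bnd_simp ltW.
rewrite (@itv_bndbnd_setU _ _ _ (BRight c)) ?bnd_simp ?ltW//.
rewrite ge0_integral_setU//.
- congr (_ + _)%E; rewrite -integral_itv_bndo_bndc//.
  by apply/measurable_EFinP; exact: measurable_funS mf.
- rewrite -itv_bndbnd_setU ?bnd_simp ?ltW//; exact/measurable_EFinP.
- move=> x xI; have {}xI : a < x < b.
    case: xI => /=; rewrite in_itv/= => /andP[x1 x2].
      by rewrite x1 (le_lt_trans x2).
    by rewrite x2 (lt_trans ac).
  by rewrite lee_fin f0.
- apply/disj_set2P/seteqP; split=> x //=; rewrite !in_itv/= => -[/andP[_ xc] /andP[cx _]].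
  by move: (le_lt_trans xc cx); rewrite ltxx.
Qed.

(* Endpoint singularities are allowed: [f] need not be bounded near [a] or [b]. *)
Lemma ge0_integral_oo_FTC (R : realType) (f A : R -> R) (a b : R) : a < b ->
  (forall x, a < x < b -> 0 <= f x) -> {in `]a, b[, continuous f} ->
  (forall x, a < x < b -> is_derive x 1 A (f x)) ->
  {within `[a, b], continuous A} ->
  (\int[mu]_(x in `]a, b[) (f x)%:E = (A b - A a)%:E)%E.
Proof.
move=> ab f0 cf dA /(continuous_within_itvP _ ab)[cA Aa Ab].
pose c := (a + b) / 2.
(* With [n.+2] already [d 0] is less than half the length of the interval, so every
   [[a + d n, b - d n]] is nondegenerate. Nonnegativity of [f] then allows monotone convergence
   along this exhaustion. *)
pose d (n : nat) : R := (b - c) / n.+2%:R.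
have bc : 0 < b - c by rewrite /c; lra.
have d0 n : 0 < d n by rewrite divr_gt0.
have dle n : d n < b - c by rewrite ltr_pdivrMr ?ltr0n// ltr_pMr// ltr1n.
have dlt n : a + d n < b - d n by have := dle n; rewrite /c; lra.
have d_cvg : d n @[n --> \oo] --> 0.
  rewrite -(mulr0 (b - c)); apply: cvgMr.
  by rewrite (cvg_shiftS (fun n => n.+1%:R^-1 : R)); exact: cvg_harmonic.
pose E n := `[a + d n, b - d n]%classic.
have EU : \bigcup_n E n = `]a, b[%classic.
  apply/seteqP; split=> x /=.
    move=> [n _]; rewrite /E/= !in_itv/= => /andP[ax xb].
    by have := d0 n => dn; apply/andP; split; lra.
  rewrite in_itv/= => /andP[ax xb].
  have m0 : 0 < Num.min (x - a) (b - x) by rewrite lt_min; lra.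
  move/cvgrPdist_lt : d_cvg => /(_ _ m0) [n _ /(_ n (leqnn n))] /=.
  rewrite sub0r normrN gtr0_norm// lt_min => /andP[xa bx].
  by exists n => //; rewrite /E/= in_itv/=; apply/andP; split; lra.
have Esub n : E n `<=` `]a, b[.
  by rewrite -EU; exact: bigcup_sup.
have mf := in_continuous_measurable_oo cf.
rewrite -EU.
have h1 : (\int[mu]_(x in E n) (f x)%:E @[n --> \oo] -->
    \int[mu]_(x in \bigcup_n E n) (f x)%:E)%E.
  apply: ge0_nondecreasing_set_cvg_integral.
  - move=> n m nm; apply/subsetPset; rewrite /E; apply: subset_itvScc.
    + rewrite bnd_simp lerD2l /d ler_pM2l// lef_pV2 ?posrE ?ltr0n// ler_nat//.
    + rewrite bnd_simp lerD2l lerN2 /d ler_pM2l// lef_pV2 ?posrE ?ltr0n// ler_nat//.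
  - by move=> n; exact: measurable_itv.
  - by move=> n; apply/measurable_EFinP; exact: measurable_funS mf.
  - by move=> n x /Esub /=; rewrite in_itv/= lee_fin => /f0.
have h2 n : (\int[mu]_(x in E n) (f x)%:E = (A (b - d n) - A (a + d n))%:E)%E.
  have sub x : a + d n <= x <= b - d n -> a < x < b.
    by have := d0 n => ? /andP[? ?]; apply/andP; split; lra.
  rewrite (@continuous_FTC2 _ _ A)//.
  - apply: continuous_in_subspaceT => x; rewrite inE/= in_itv/= => /sub xab.
    by apply: cf; rewrite in_itv.
  - split.
    + move=> x; rewrite in_itv/= => /andP[/ltW xa /ltW xb].
      have xab : a < x < b by apply: sub; rewrite xa xb.
      by have [] := dA x xab.
    + apply: cvg_at_right_filter; apply: cA; rewrite in_itv/=; apply: sub.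
      by rewrite lexx ltW.
    + apply: cvg_at_left_filter; apply: cA; rewrite in_itv/=; apply: sub.
      by rewrite lexx ltW.
  - move=> x; rewrite in_itv/= => /andP[/ltW xa /ltW xb].
    have xab : a < x < b by apply: sub; rewrite xa xb.
    by rewrite derive1E; have [_ ->] := dA x xab.
have h3 : (A (b - d n) - A (a + d n)) @[n --> \oo] --> A b - A a.
  apply: cvgB.
  - move/cvg_at_leftP : Ab; apply; split.
      by move=> n; have := d0 n; lra.
    by rewrite -[X in _ --> X]subr0; apply: cvgB => //; exact: cvg_cst.
  - move/cvg_at_rightP : Aa; apply; split.
      by move=> n; have := d0 n; lra.
    by rewrite -[X in _ --> X]addr0; apply: cvgD => //; exact: cvg_cst.
move: h1; under eq_fun do rewrite h2; move=> h1.
by apply: (cvg_unique _ h1) => //; apply: cvg_EFin => //; exact: nearW.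
Unshelve. all: by end_near. Qed.

Lemma antiderivative_oo (R : realType) (f : R -> R) (a b : R) : a < b ->
  mu.-integrable `]a, b[ (EFin \o f) -> {in `]a, b[, continuous f} ->
  exists A : R -> R, [/\ {within `[a, b], continuous A},
    forall x, a < x < b -> is_derive x 1 A (f x) &
    (\int[mu]_(x in `]a, b[) (f x)%:E)%E = (A b - A a)%:E].
Proof.
move=> ab fi cf; have fi' := integrable_oo_cc fi.
exists (fun x => \int[mu]_(t in `[a, x]) f t)%R; split.
- exact: (parameterized_integral_continuous (ltW ab) fi').
- move=> x /andP[ax xb].
  have cx : {for x, continuous f} by apply: cf; rewrite in_itv/= ax.
  have [h1 h2] := continuous_FTC1_closed xb fi' ax cx.
  by split; [exact: h1|rewrite -derive1E; exact: h2].
- rewrite set_itv1 Rintegral_set1 subr0 /Rintegral fineK; last first.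
    exact: integrable_fin_num.
  rewrite integral_itv_seg//.
  by move/integrableP : fi => [/measurable_EFinP].
Qed.

(** * Inversion of the time map *)

Lemma strictly_decreasing_seg (R : realType) (X dX : R -> R) (m : R) :
  (forall s, 0 < s < m -> is_derive s 1 X (dX s)) ->
  (forall s, 0 < s < m -> dX s < 0) ->
  (forall e, 0 < e < m -> {within `[e, m], continuous X}) ->
  forall s t, 0 < s -> s < t -> t <= m -> X t < X s.
Proof.
move=> dXE dX0 cX s t s0 st tm; rewrite -subr_lt0.
have sub x : x \in `]s, t[ -> 0 < x < m.
  by rewrite in_itv/= => /andP[sx xt]; rewrite (lt_trans s0)//= (lt_le_trans xt).
have [] := @MVT _ X dX s t st.
- by move=> x /sub xm; exact: dXE.
- have sm : 0 < s < m by rewrite s0 (lt_le_trans st).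
  by apply: continuous_subspaceW (cX s sm); apply: subset_itvl; rewrite bnd_simp.
- by move=> c /sub /dX0 c0 ->; rewrite nmulr_rlt0 ?subr_gt0.
Qed.

(** [X s] is the time in which the profile descends from its maximum [m] to the level [s]. As [q] is
    integrable only away from [0], [X] may or may not be bounded there. *)
Lemma time_map (R : realType) (q : R -> R) (m : R) :
  (forall s, 0 < s < m -> 0 < q s) ->
  (forall s, 0 < s < m -> {for s, continuous q}) ->
  (forall e, 0 < e < m -> mu.-integrable `]e, m[ (EFin \o q)) ->
  exists X : R -> R, [/\ X m = 0,
    forall s, 0 < s < m -> is_derive s 1 X (- q s) &
    forall e, 0 < e < m -> {within `[e, m], continuous X}].
Proof.
move=> q0 cq qi; pose X s := (\int[mu]_(t in `[s, m]) q t)%R.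
(* On [[e, m]] the integral with variable lower endpoint is a constant minus one with variable upper
   endpoint, to which the fundamental theorem applies. *)
have XE e : 0 < e < m -> exists A : R -> R,
    [/\ {within `[e, m], continuous A},
        forall s, e < s < m -> is_derive s 1 A (q s) &
        forall s, e <= s <= m -> X s = A m - A s].
  move=> /andP[e0 em]; have emi : 0 < e < m by rewrite e0.
  have qi' := integrable_oo_cc (qi e emi).
  exists (fun x => \int[mu]_(t in `[e, x]) q t)%R; split.
  - exact: (parameterized_integral_continuous (ltW em) qi').
  - move=> s /andP[es sm].
    have cs : {for s, continuous q} by apply: cq; rewrite sm (lt_trans e0).
    have [h1 h2] := continuous_FTC1_closed sm qi' es cs.
    by split; [exact: h1|rewrite -derive1E; exact: h2].
  - move=> s /andP[es sm]; rewrite Rintegral_itvB ?bnd_simp//.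
    rewrite Rintegral_itv_obnd_cbnd//.
    apply: integrableS qi' => //.
    by apply: subset_itv; rewrite bnd_simp.
exists X; split.
- by rewrite /X set_itv1 Rintegral_set1.
- move=> s /andP[s0 sm].
  have [|A [_ dA AE]] := XE (s / 2); first by apply/andP; split; lra.
  have sA : s / 2 < s < m by apply/andP; split; lra.
  have dXs : is_derive s 1 (cst (A m) - A) (0 - q s).
    by have ? := dA s sA; exact: is_deriveB.
  rewrite -[- q s]sub0r; apply: near_eq_is_derive dXs.
  have : s \in `](s / 2), m[ by rewrite in_itv.
  move/near_in_itvoo; apply: filterS => x; rewrite in_itv/= => /andP[x1 x2].
  by rewrite AE// !ltW.
- move=> e em; have [A [cA _ AE]] := XE e em.
  have cB : {within `[e, m], continuous (fun s => A m - A s)}.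
    by move=> x; apply: cvgB; [exact: cvg_cst|exact: cA].
  apply: subspace_eq_continuous cB => x; rewrite inE/= in_itv/= => xem.
  exact: (esym (AE x xem)).
Qed.

(** Bounded and unbounded time maps are treated together: [u x] is the level reached at time [|x|],
    and [0] once all positive levels have been passed. *)
Lemma time_map_inverse (R : realType) (q : R -> R) (m : R) : 0 < m ->
  (forall s, 0 < s < m -> 0 < q s) ->
  (forall s, 0 < s < m -> {for s, continuous q}) ->
  (forall e, 0 < e < m -> mu.-integrable `]e, m[ (EFin \o q)) ->
  exists u : R -> R, [/\ continuous u /\ u 0 = m,
    forall x, 0 <= u x <= m, forall x, u (- x) = u x,
    forall x, 0 < x -> 0 < u x -> u x < m /\ is_derive x 1 u (- (q (u x))^-1) &
    (forall x y, 0 <= x <= y -> u y <= u x) /\ u x @[x --> +oo] --> 0].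
Proof.
move=> m0 q0 cq qi; have [X [Xm dX cX]] := time_map q0 cq qi.
have Xlt : forall s t, 0 < s -> s < t -> t <= m -> X t < X s.
  apply: strictly_decreasing_seg dX _ cX => s /q0; lra.
have Xle s t : 0 < s -> s <= t -> t <= m -> X t <= X s.
  by move=> s0; rewrite le_eqVlt => /predU1P[->//|st tm]; exact/ltW/Xlt.
pose T (x : R) := [set s : R | 0 < s <= m /\ X s = `|x|].
(* The default value [0] is meaningful: it is taken exactly when no level in [(0, m]] is reached at
   time [|x|]. *)
pose u (x : R) : R := xget 0 (T x).
have uP x : 0 < u x -> 0 < u x <= m /\ X (u x) = `|x|.
  rewrite /u; case: xgetP => [y _ []|_]; [by []|by rewrite ltxx].
have u0 x : 0 <= u x.
  by rewrite /u; case: xgetP => // y _ [/andP[/ltW]].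
have um x : u x <= m.
  by rewrite /u; case: xgetP => [y _ [/andP[_]]//|_]; exact: ltW.
(* This equivalence characterizes [u] as the generalized inverse of [X]; continuity, monotonicity
   and the limit at infinity are all read off from it. *)
have uE x s : 0 < s -> s <= m -> (s <= u x) = (`|x| <= X s).
  move=> s0 sm; apply/idP/idP => [su|xX].
    have [_ <-] := uP x (lt_le_trans s0 su).
    exact: Xle.
  have cXs : {within `[s, m], continuous X}.
    move: sm; rewrite le_eqVlt => /predU1P[->|sm].
      by rewrite set_itv1; exact: continuous_subspace1.
    by apply: cX; rewrite s0.
  have [|t tI Xt] := @IVT _ X s m `|x| sm cXs.
    by rewrite Xm ge_min le_max normr_ge0 xX orbT.
  have uT : T x (u x).
    apply: (@xgetPex _ 0 (T x)); exists t; split=> //.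
    by move: tI; rewrite in_itv/= => /andP[st ->]; rewrite (lt_le_trans s0 st).
  have [/andP[ux0 _] Xu] := uT.
  by rewrite leNgt; apply/negP => us; have := Xlt _ _ ux0 us sm; lra.
have uX s : 0 < s -> s <= m -> u (X s) = s.
  move=> s0 sm; have Xs0 : 0 <= X s by rewrite -Xm; exact: Xle.
  apply/eqP; rewrite eq_le (uE _ s)// ger0_norm// lexx andbT leNgt.
  apply/negP => su; have [_] := uP (X s) (lt_trans s0 su).
  by rewrite ger0_norm// => XX; have := Xlt _ _ s0 su (um _); lra.
have cu (x : R) : u y @[y --> x] --> u x.
  apply/cvgrPdist_lt => e e0.
  have cn : `|y| @[y --> x] --> `|x| by exact: norm_continuous.
  have H1 : \forall y \near x, u x - e < u y.
    have [ue|ue] := ltP (u x - e) 0.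
      by near=> y; exact: lt_le_trans (u0 y).
    have ux0 : 0 < u x by lra.
    pose s := u x - e / 2.
    have s0 : 0 < s by rewrite /s; lra.
    have sm : s <= m by have := um x; rewrite /s; lra.
    have xX : `|x| < X s.
      by have [_ <-] := uP x ux0; apply: Xlt; rewrite ?um// /s; lra.
    have := @cvgr_lt _ _ (nbhs x) (nbhs_filter x) _ _ cn _ xX; apply: filterS => y yX.
    by have : s <= u y by [rewrite uE// ltW]; rewrite /s; lra.
  have H2 : \forall y \near x, u y < u x + e.
    have [ue|ue] := leP (u x + e) m; last first.
      by near=> y; exact: le_lt_trans (um y) _.
    have s0 : 0 < u x + e by have := u0 x; lra.
    have xX : X (u x + e) < `|x| by rewrite ltNge -uE// -ltNge; lra.
    have := @cvgr_gt _ _ (nbhs x) (nbhs_filter x) _ _ cn _ xX; apply: filterS => y yX.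
    by rewrite ltNge uE// -ltNge.
  by near=> y; rewrite ltr_norml; apply/andP; split;
    [have : u y < u x + e by near: y | have : u x - e < u y by near: y]; lra.
exists u; split.
- split=> //; apply/eqP; rewrite eq_le um uE// normr0.
  by rewrite Xm lexx.
- by move=> x; rewrite u0 um.
- by move=> x; rewrite /u /T normrN.
- move=> x x0 ux0; have [/andP[_ _] Xu] := uP x ux0.
  rewrite gtr0_norm// in Xu.
  have um' : u x < m.
    rewrite lt_neqAle um andbT; apply/eqP => uxm.
    by move: Xu; rewrite uxm Xm => x0'; rewrite -x0' ltxx in x0.
  split=> //.
  have uxI : u x \in `]0, m[ by rewrite in_itv/= ux0.
  have uxm : 0 < u x < m by rewrite ux0.
  rewrite -{1}Xu -invrN; apply: (@is_derive_inverse _ X).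
  + have := near_in_itvoo uxI; apply: filterS => s; rewrite in_itv/= => /andP[s0 sm].
    by rewrite uX// ltW.
  + have := near_in_itvoo uxI; apply: filterS => s; rewrite in_itv/= => sm.
    exact: is_derive_continuous (dX s sm).
  + exact: dX.
  + by rewrite oppr_eq0 gt_eqF// q0.
- split.
  + move=> x y /andP[x0 xy]; rewrite leNgt; apply/negP => uxy.
    have uy0 : 0 < u y by exact: le_lt_trans (u0 x) uxy.
    have [_ Xu] := uP y uy0.
    have : u y <= u x by rewrite uE// Xu !ger0_norm// (le_trans x0).
    by rewrite leNgt uxy.
  + apply/cvgrPdist_lt => e e0.
    pose d := Num.min e m.
    have d0 : 0 < d by rewrite lt_min e0.
    have dm : d <= m by rewrite ge_min lexx orbT.
    near=> x; rewrite sub0r normrN ger0_norm//.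
    apply: (@lt_le_trans _ _ d); last by rewrite ge_min lexx.
    rewrite ltNge uE// -ltNge (lt_le_trans _ (ler_norm _))//.
    by near: x; apply: nbhs_pinfty_gt; exact: num_real.
Unshelve. all: by end_near. Qed.

Lemma cvg_within_comp (R : realType) (T : Type) (A : set R) (f : R -> R)
    (u : T -> R) (F : set_system T) (l : R) {FF : Filter F} :
  {within A, continuous f} -> A l -> (\forall x \near F, A (u x)) ->
  u x @[x --> F] --> l -> f (u x) @[x --> F] --> f l.
Proof.
move=> /subspace_continuousP cf Al Au ul.
have ul' : u x @[x --> F] --> within A (nbhs l).
  move=> B wB; have {}wB : nbhs l (fun y => A y -> B y) by exact: wB.
  have : F (u @^-1` (fun y => A y -> B y)) by exact: ul.
  move=> h; suff : F (u @^-1` B) by [].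
  by apply: filterS2 Au h => x /= Aux; apply.
exact: cvg_trans (cvg_app f ul') (cf l Al).
Qed.

(* The support of [u] may be bounded; at its right end the derivative exists because
   the derivatives on the left have limit [0]. *)
Lemma is_derive_zero_tail (R : realType) (f u : R -> R) (g : R -> R) (c : R) :
  {in `]0, +oo[, continuous f} -> {in `]0, +oo[, continuous g} ->
  (forall x, 0 <= u x) -> (forall x y, 0 <= x <= y -> u y <= u x) ->
  (forall x, u x = 0 -> f x = c /\ g x = 0) ->
  (forall x : R, 0 < x -> 0 < u x -> is_derive x 1 f (g x)) ->
  forall x : R, 0 < x -> is_derive x 1 f (g x).
Proof.
move=> cf cg u0 uanti fc dfg x x0.
have [ux0|] := ltP 0 (u x); first exact: dfg.
move=> ux; have {}ux : u x = 0 by apply/eqP; rewrite eq_le ux u0.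
have utail y z : 0 < y -> y <= z -> u y = 0 -> u z = 0.
  move=> y0 yz uy; apply/eqP; rewrite eq_le u0 andbT -uy.
  by apply: uanti; rewrite ltW.
have flat (y a : R) : 0 < a -> a < y -> u a = 0 -> is_derive y 1 f (g y).
  move=> a0 ay ua.
  rewrite (fc y _).2; last by apply: (utail a) => //; exact: ltW.
  apply: near_eq_is_derive (is_derive_cst c y 1); near=> z.
  rewrite (fc z _).1//; apply: (utail a) => //; apply: ltW.
  by near: z; exact: lt_nbhsr.
(* Either [u] vanishes before [x], and [f] is constant around [x], or [x] is the edge of the
   support, where only a punctured neighbourhood can be handled directly. *)
have [[a [a0 ax ua]]|nex] := pselect (exists a, [/\ 0 < a, a < x & u a = 0]).
  exact: flat ua.
apply: is_derive_punctured.
- by apply: cf; rewrite in_itv/= x0.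
- by apply: cg; rewrite in_itv/= x0.
- near=> y; have y0 : 0 < y.
    near: y; have : \forall y \near x, 0 < y by exact: lt_nbhsr.
    exact: nbhs_dnbhs.
  have [yx|xy|yx] := ltgtP y x.
  + apply: dfg => //; rewrite lt_neqAle u0 andbT; apply/eqP => uy.
    by apply: nex; exists y.
  + exact: flat xy ux.
  + by have : y != x by [near: y; exact: nbhs_dnbhs_neq]; rewrite yx eqxx.
Unshelve. all: by end_near. Qed.

(** The sign [s] lets one statement serve the even [u] and its odd derivative. Reflection covers
    [x < 0], and continuity of [g] closes the gap at [0]. *)
Lemma is_derive_parity (R : realType) (f g : R -> R) (s : R) : s ^+ 2 = 1 ->
  (forall x, f (- x) = s * f x) -> (forall x, g (- x) = - s * g x) ->
  {for 0, continuous f} -> {for 0, continuous g} ->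
  (forall x : R, 0 < x -> is_derive x 1 f (g x)) -> forall x : R, is_derive x 1 f (g x).
Proof.
move=> s2 fs gs cf0 cg0 dfg.
have dneq (x : R) : x != 0 -> is_derive x 1 f (g x).
  case: (ltgtP x 0) => // [x0 _|x0 _]; last exact: dfg.
  have fE : f = (fun y => s * f (- y)).
    by apply/funext => y; rewrite fs mulrA -expr2 s2 mul1r.
  have nx0 : 0 < - x by rewrite oppr_gt0.
  have dN : is_derive x 1 (fun y : R => - y) (-1) by exact: is_deriveN.
  have dc := is_derive1_comp (dfg _ nx0) dN.
  have ds : is_derive x 1 (s \*: (f \o -%R)) (s *: (g (- x) * -1)).
    exact: is_deriveZ.
  rewrite fE.
  have -> : g x = s *: (g (- x) * -1).
    rewrite gs /GRing.scale/=.
    by transitivity (s ^+ 2 * g x); [rewrite s2 mul1r|ring].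
  exact: ds.
move=> x; have [->|] := eqVneq x 0; last exact: dneq.
apply: is_derive_punctured => //; near=> y; apply: dneq.
by near: y; exact: nbhs_dnbhs_neq.
Unshelve. all: by end_near. Qed.

(** * Construction of the solution *)

Lemma even_integral_FTC (R : realType) (f F : R -> R) (l : R) :
  continuous f -> (forall x, 0 <= f x) -> (forall x, f (- x) = f x) ->
  continuous F -> (forall x : R, 0 < x -> is_derive x 1 F (f x)) ->
  F x @[x --> +oo] --> l ->
  (\int[mu]_x (f x)%:E = (2 * (l - F 0))%:E)%E.
Proof.
move=> cf f0 fN cF dF Fl.
rewrite ge0_symfun_integralT//; last by move=> x /=; rewrite fN.
rewrite EFinM; congr (_ * _)%E; rewrite -set_itvcy EFinB.
apply: ge0_continuous_FTC2y => //.
- exact: continuous_subspaceT.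
- by move=> x /dF [].
- by apply: cvg_at_right_filter; exact: cF.
- by move=> x; rewrite in_itv/= andbT => /dF [_ <-]; rewrite derive1E.
Qed.

Lemma Lfun2_sqr (R : realType) (f : R -> R) :
  measurable_fun setT f -> (\int[mu]_x (f x ^+ 2)%:E < +oo)%E ->
  f \in Lfun (@lebesgue_measure R) 2%:E.
Proof.
move=> mf fi; apply/andP; split; first by rewrite inE.
rewrite inE/= /finite_norm unlock /Lnorm; apply: poweR_lty.
apply: le_lt_trans fi; rewrite le_eqVlt; apply/orP; left; apply/eqP.
apply: eq_integral => x _ /=.
by rewrite powR_mulrn ?normr_ge0// real_normK ?num_real.
Qed.

(** The profile solves [u' = - sqrt (2 P(u))] for [x > 0], so its time map has density
    [1 / sqrt (2 P)]. Finiteness of the mass integral is the only control on [P] near its zeros. *)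
Lemma ground_state (R : realType) (P p k : R -> R) (m : R) : 0 < m ->
  continuous P -> continuous p -> continuous k ->
  P 0 = 0 -> P m = 0 -> p 0 = 0 -> k 0 = 0 ->
  (forall s, 0 < s < m -> 0 < P s) ->
  (forall s : R, 0 < s < m -> is_derive s 1 P (p s)) ->
  (forall s, 0 < s -> 0 < k s) ->
  mu.-integrable `]0, m[ (EFin \o (fun s => k s / Num.sqrt (2 * P s))) ->
  exists u : R -> R, C2 u /\ (forall x, 0 <= u x) /\
    (forall x, derive1n 2 u x = p (u x)) /\
    (\int[mu]_x (k (u x))%:E =
      2%:E * \int[mu]_(s in `]0%R, m[) (k s / Num.sqrt (2 * P s))%:E)%E /\
    derive1 u \in Lfun (@lebesgue_measure R) 2%:E /\
    (forall x, u (- x) = u x) /\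
    u x @[x --> +oo] --> 0 /\ u x @[x --> -oo] --> 0.
Proof.
move=> m0 cP cp ck P0 Pm p0 k0 Ppos dP kpos ki.
pose Q s := Num.sqrt (2 * P s).
have cQ : continuous Q.
  move=> s; apply: (continuous_comp (f := fun s => 2 * P s)); last exact: sqrt_continuous.
  by apply: cvgMr; exact: cP.
have Q0 : Q 0 = 0 by rewrite /Q P0 mulr0 sqrtr0.
have Qm : Q m = 0 by rewrite /Q Pm mulr0 sqrtr0.
have Qpos s : 0 < s < m -> 0 < Q s by move=> /Ppos Ps; rewrite sqrtr_gt0; lra.
have cQV (s : R) : 0 < s < m -> {for s, continuous (fun s => (Q s)^-1)}.
  by move=> /Qpos Qs; apply: continuousV; [rewrite gt_eqF|exact: cQ].
have Qi e : 0 < e < m -> mu.-integrable `]e, m[ (EFin \o (fun s => (Q s)^-1)).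
  move=> /andP[e0 em].
  (* On [[e, m]] the positive function [k] is bounded below, so integrability of [k / Q] yields that
     of [1 / Q] up to the singular end [m]. *)
  have [c cI ckc] := EVT_min (ltW em) (continuous_subspaceT ck).
  have kc : 0 < k c by apply: kpos; move: cI; rewrite in_itv/= => /andP[ec _]; lra.
  have emI : `]e, m[ `<=` `]0, m[ by apply: subset_itvr; rewrite bnd_simp ltW.
  have gi : mu.-integrable `]e, m[
      (EFin \o (fun s : R => (k c)^-1 * (k s / Num.sqrt (2 * P s)))).
    by apply: integrable_scale; apply: integrableS ki.
  apply: (le_integrable _ _ _ gi) => //.
  - apply/measurable_EFinP; apply: in_continuous_measurable_oo => s.
    by rewrite in_itv/= => /andP[es sm]; apply: cQV; rewrite sm (lt_trans e0).
  - move=> s /=; rewrite in_itv/= => /andP[es sm].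
    have s0 : 0 < s < m by rewrite sm (lt_trans e0).
    have Qs : 0 < (Q s)^-1 by rewrite invr_gt0 Qpos.
    rewrite lee_fin -/(Q s) mulrA normrM (gtr0_norm Qs) ler_peMl ?(ltW Qs)//.
    have ksc : k c <= k s by apply: ckc; rewrite in_itv/= !ltW.
    by rewrite (le_trans _ (ler_norm _))// ler_pdivlMl// mulr1.
have [u [[cu u0m] uI uN du [uanti uy]]] := time_map_inverse m0
  (fun s sI => etrans (invr_gt0 _) (Qpos s sI)) cQV Qi.
have {}du (x : R) : 0 < x -> 0 < u x -> u x < m /\ is_derive x 1 u (- Q (u x)).
  by move=> x0 ux0; have [ux] := du x x0 ux0; rewrite invrK.
have u0 x : 0 <= u x by have /andP[] := uI x.
pose w x := Q (u x).
have cw : continuous w by move=> x; apply: continuous_comp; [exact: cu|exact: cQ].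
have cNw : continuous (fun x => - w x) by move=> x; apply: cvgN; exact: cw.
have w0 x : 0 <= w x by exact: sqrtr_ge0.
have du1 (x : R) : 0 < x -> is_derive x 1 u (- w x).
  apply: (is_derive_zero_tail (u := u) (c := 0) (g := fun x => - w x)) => //.
  - by move=> y uy0; rewrite /w uy0 Q0 oppr0.
  - by move=> y y0 /(du y y0) [].
have cpu : continuous (p \o u).
  by move=> x; apply: continuous_comp; [exact: cu|exact: cp].
have dw (x : R) : 0 < x -> is_derive x 1 (fun x => - w x) (p (u x)).
  apply: (is_derive_zero_tail (u := u) (c := 0) (g := p \o u)) => //.
  - by move=> y uy0; rewrite /w/= uy0 Q0 oppr0.
  - move=> y y0 uy0 /=; have [um duy] := du y y0 uy0.
    have uym : 0 < u y < m by rewrite uy0.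
    have P2 : 0 < 2 * P (u y) by have := Ppos _ uym; lra.
    have d1 : is_derive (u y) 1 (2 \*: P) (2 *: p (u y)).
      by have := dP _ uym => ?; exact: is_deriveZ.
    have ds : is_derive ((2 \*: P) (u y)) 1 Num.sqrt
        (2 * Num.sqrt (2 * P (u y)))^-1 := is_derive1_sqrt P2.
    have d2 := is_derive1_comp ds d1.
    have d3 := is_derive1_comp d2 duy.
    have d4 := is_deriveN d3.
    (* The factor [Q (u y)] coming from [u'] cancels the one in the derivative of the square root;
       this is how the second-order equation follows from the first-order one. *)
    have -> : p (u y) =
        - ((2 * Num.sqrt (2 * P (u y)))^-1 * (2 *: p (u y)) * - Q (u y)).
      rewrite /GRing.scale/= -/(Q (u y)); field.
      by rewrite gt_eqF// Qpos.
    exact: d4.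
(* The odd extension of [- w]. It has no jump at [0], because [w 0 = Q m = 0]. *)
pose v x := - Num.sg x * w x.
have vpos x : 0 < x -> v x = - w x by move=> x0; rewrite /v gtr0_sg// mulN1r.
have wN x : w (- x) = w x by rewrite /w uN.
have vN x : v (- x) = - v x by rewrite /v wN sgrN opprK mulNr opprK.
have w00 : w 0 = 0 by rewrite /w u0m.
have cv0 : {for 0, continuous v}.
  apply/cvgrPdist_lt => e e0; near=> x.
  rewrite {1}/v w00 mulr0 sub0r normrN /v normrM normrN.
  apply: (@le_lt_trans _ _ `|w x|).
    by rewrite ler_piMl// normr_sg lern1 leq_b1.
  near: x; have := cw 0 => /cvgrPdist_lt /(_ e e0).
  by apply: filterS => x; rewrite w00 sub0r normrN.
have du2 (x : R) : is_derive x 1 u (v x).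
  apply: (@is_derive_parity _ _ _ 1) => //.
  - by rewrite expr1n.
  - by move=> y; rewrite mul1r.
  - by move=> y; rewrite vN mulN1r.
  - exact: cu.
  - by move=> y y0; rewrite vpos//; exact: du1.
have dv (x : R) : is_derive x 1 v (p (u x)).
  apply: (@is_derive_parity _ _ (p \o u) (- 1)) => //.
  - by rewrite sqrrN expr1n.
  - by move=> y; rewrite vN mulN1r.
  - by move=> y; rewrite /= uN opprK mul1r.
  - exact: cpu.
  - move=> y y0; apply: near_eq_is_derive (dw y y0).
    near=> z; rewrite vpos//.
    by near: z; exact: lt_nbhsr.
have u'E : derive1 u = v.
  by apply/funext => x; rewrite derive1E; have [_ ->] := du2 x.
have u''E : derive1n 2 u = p \o u.
  have -> : derive1n 2 u = derive1 (derive1 u) by [].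
  by apply/funext => x; rewrite u'E derive1E; have [_ ->] := dv x.
have unN : u x @[x --> -oo] --> 0.
  apply/cvgNy_compNP.
  by have -> : u \o -%R = u by apply/funext => x /=; rewrite uN.
exists u; split.
  split.
  - by move=> x; have [] := du2 x.
  - by move=> x; rewrite u'E; have [] := dv x.
  - by rewrite u''E.
split=> //; split; first by move=> x; rewrite u''E.
split; last split => //.
- have kc (s : R) : s \in `]0, m[ ->
      {for s, continuous (fun s => k s / Num.sqrt (2 * P s))}.
    rewrite in_itv/= => sI; apply: cvgM; [exact: ck|exact: cQV].
  (* Change of variable [s = u x] in the form of a primitive: on [x > 0] the derivative of
     [- A (u x)] is [k (u x)]. *)
  have [A [cA dA ->]] := antiderivative_oo m0 ki kc.
  have uI' x : `[0, m]%classic (u x) by rewrite /= in_itv/=.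
  have uJ (x : R) : \forall y \near x, `[0, m]%classic (u y).
    by apply: filterE => y; exact: uI'.
  have cAu (x : R) : - A (u y) @[y --> x] --> - A (u x).
    by apply: cvgN; exact: (cvg_within_comp cA (uI' x) (uJ x) (cu x)).
  transitivity ((2 * (- A 0 - - A (u 0)))%:E); last first.
    by rewrite -EFinM u0m; congr (_ * _)%:E; ring.
  apply: (@even_integral_FTC _ (k \o u) (fun x => - A (u x))).
  + by move=> x; apply: continuous_comp; [exact: cu|exact: ck].
  + move=> x; have := u0 x; rewrite /= le_eqVlt => /predU1P[<-|/kpos/ltW//].
    by rewrite k0.
  + by move=> x; rewrite /= uN.
  + exact: cAu.
  + apply: (is_derive_zero_tail (u := u) (c := - A 0) (g := k \o u)) => //.
    * by move=> y _; exact: cAu.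
    * by move=> y _; apply: continuous_comp; [exact: cu|exact: ck].
    * by move=> y uy0; rewrite /= uy0 k0.
    * move=> y y0 uy0; have [um duy] := du y y0 uy0.
      have uym : 0 < u y < m by rewrite uy0.
      have d3 := is_derive1_comp (dA _ uym) duy.
      have d4 := is_deriveN d3.
      have -> : (k \o u) y = - (k (u y) / Num.sqrt (2 * P (u y)) * - Q (u y)).
        by rewrite -/(Q (u y)) mulrN opprK divfK// gt_eqF// Qpos.
      exact: d4.
  + apply: cvgN; apply: (cvg_within_comp cA _ (filterE _ uI')) => //.
    by rewrite /= in_itv/= lexx ltW.
- have mv : measurable_fun setT v.
    by apply: continuous_measurable_fun => x; exact: is_derive_continuous (dv x).
  rewrite u'E; apply: Lfun2_sqr => //.
  (* From [u'^2 <= (max Q) * w], square integrability reduces to integrability of [w], which on the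
     half-line is [- u'] and has integral [u 0]. *)
  have [c _ Qc] := EVT_max (ltW m0) (continuous_subspaceT cQ).
  have Qc0 : 0 <= Q c by exact: sqrtr_ge0.
  have mw : measurable_fun setT w by exact: continuous_measurable_fun.
  apply: (@le_lt_trans _ _ (\int[mu]_x (Q c * w x)%:E)%E).
    apply: ge0_le_integral => //.
    + by move=> x _; rewrite lee_fin sqr_ge0.
    + by apply/measurable_EFinP; exact: measurable_funX.
    + apply/measurable_EFinP; exact: measurable_funM.
    + move=> x _; rewrite lee_fin /v exprMn sqrrN -[X in _ <= X]mul1r.
      have wc : w x <= Q c by apply: Qc; rewrite in_itv/=.
      apply: ler_pM; rewrite ?sqr_ge0//.
        by rewrite -real_normK ?num_real// expr_le1// normr_sg lern1 leq_b1.
      by rewrite expr2 ler_wpM2r.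
  under eq_integral do rewrite EFinM.
  rewrite ge0_integralZl//; last 2 first.
    exact/measurable_EFinP.
    by move=> x _; rewrite lee_fin.
  have -> : (\int[mu]_x (w x)%:E = (2 * (0 - - u 0))%:E)%E; last first.
    by rewrite -EFinM ltry.
  apply: (@even_integral_FTC _ w (fun x => - u x)) => //.
  + by move=> x; apply: cvgN; exact: cu.
  + by move=> x x0; rewrite -[w x]opprK; have := du1 x x0 => ?; exact: is_deriveN.
  + by rewrite -oppr0; exact: cvgN.
Unshelve. all: by end_near. Qed.

(** * Weights and their primitives *)

(** The half-open interval is that of [Phi], so [Phi G K t] is [primitive (weight G K) t ^+ 2] by
    mere unfolding. *)
Definition primitive (R : realType) (w : R -> R) (t : R) : R :=
  (\int[mu]_(s in `]0, t]) w s)%R.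

Record weight_profile (R : realType) (w : R -> R) : Prop := WeightProfile {
  weight_gt0 : forall s, 0 < s -> 0 < w s ;
  weight_continuous : forall s : R, 0 < s -> {for s, continuous w} ;
  weight_integrable : forall b, mu.-integrable `]0, b[ (EFin \o w)
}.

Lemma primitiveE (R : realType) (w : R -> R) (t : R) : weight_profile w ->
  primitive w t = (\int[mu]_(s in `[0, t]) w s)%R.
Proof.
move=> hw; apply: Rintegral_itv_obnd_cbnd.
have := integrable_oo_cc (weight_integrable hw t).
apply: integrableS => //.
by apply: subset_itvr; rewrite bnd_simp.
Qed.

Lemma primitive0 (R : realType) (w : R -> R) : primitive w 0 = 0.
Proof. by rewrite /primitive set_itv_ge ?bnd_simp ?ltxx// Rintegral_set0. Qed.

Lemma is_derive_primitive (R : realType) (w : R -> R) (s : R) :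
  weight_profile w -> 0 < s -> is_derive s 1 (primitive w) (w s).
Proof.
move=> hw s0; have ss : s < s + 1 by rewrite ltrDl.
have [h1 h2] := continuous_FTC1_closed ss
  (integrable_oo_cc (weight_integrable hw (s + 1))) s0 (weight_continuous hw s0).
have -> : primitive w = (fun x => \int[mu]_(t in `[0, x]) w t)%R.
  by apply/funext => x; exact: primitiveE.
by split; [exact: h1|rewrite -derive1E; exact: h2].
Qed.

Lemma primitive_continuous (R : realType) (w : R -> R) (b : R) :
  weight_profile w -> 0 <= b -> {within `[0, b], continuous (primitive w)}.
Proof.
move=> hw b0; have -> : primitive w = (fun x => \int[mu]_(t in `[0, x]) w t)%R.
  by apply/funext => x; exact: primitiveE.
exact: (parameterized_integral_continuous b0
  (integrable_oo_cc (weight_integrable hw b))).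
Qed.

Lemma in_continuous_weight (R : realType) (w : R -> R) (a b : R) :
  weight_profile w -> 0 <= a -> {in `]a, b[, continuous w}.
Proof.
move=> hw a0 s; rewrite in_itv/= => /andP[as_ _].
exact: weight_continuous hw _ (le_lt_trans a0 as_).
Qed.

Lemma integral_primitive (R : realType) (w : R -> R) (a b : R) :
  weight_profile w -> 0 <= a -> a < b ->
  (\int[mu]_(s in `]a, b[) (w s)%:E = (primitive w b - primitive w a)%:E)%E.
Proof.
move=> hw a0 ab; apply: ge0_integral_oo_FTC => //.
- by move=> s /andP[as_ _]; exact/ltW/(weight_gt0 hw)/(le_lt_trans a0).
- exact: in_continuous_weight.
- by move=> s /andP[as_ _]; apply: is_derive_primitive => //; exact: le_lt_trans as_.
- apply: continuous_subspaceW (primitive_continuous hw (ltW (le_lt_trans a0 ab))).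
  by apply: subset_itvr; rewrite bnd_simp.
Qed.

Lemma primitive_lt (R : realType) (w : R -> R) (a b : R) :
  weight_profile w -> 0 <= a -> a < b -> primitive w a < primitive w b.
Proof.
move=> hw a0 ab; have b0 := le_lt_trans a0 ab.
have [|| c] := @MVT _ (primitive w) w a b ab.
- move=> x; rewrite in_itv/= => /andP[ax _]; apply: is_derive_primitive => //.
  exact: le_lt_trans ax.
- apply: continuous_subspaceW (primitive_continuous hw (ltW b0)).
  by apply: subset_itvr; rewrite bnd_simp.
- rewrite in_itv/= => /andP[ac _] E.
  by rewrite -subr_gt0 E mulr_gt0 ?subr_gt0//; exact/(weight_gt0 hw)/(le_lt_trans a0).
Qed.

Lemma primitive_gt0 (R : realType) (w : R -> R) (b : R) :
  weight_profile w -> 0 < b -> 0 < primitive w b.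
Proof. by move=> hw b0; rewrite -(primitive0 w); exact: primitive_lt. Qed.

(** Continuity up to [1] is the point: [W s / W b] reaches [1] at [s = b], where [asin] is not
    differentiable. It comes from inverting the sine on a closed interval. *)
Lemma asin_within_continuous (R : realType) :
  {within `[(-1 : R), 1], continuous (@asin R)}.
Proof.
have := @segment_can_le_continuous R (- (pi / 2)) (pi / 2) sin (@asin R).
rewrite sinN sin_pihalf; apply.
- by rewrite (@le_trans _ _ 0)// ?oppr_le0 divr_ge0// pi_ge0.
- by apply: continuous_subspaceT => x; exact: continuous_sin.
- exact: sinK.
Qed.

(** With [r = W s / W b] the integrand is [r' / sqrt (1 - r^2)]. For [a = 0] the value is [pi / 2],
    whatever [w] and [b]. *)
Lemma integral_arcsine (R : realType) (w : R -> R) (a b : R) :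
  weight_profile w -> 0 <= a -> a < b ->
  (\int[mu]_(s in `]a, b[)
     (w s / Num.sqrt (primitive w b ^+ 2 - primitive w s ^+ 2))%:E =
   (pi / 2 - asin (primitive w a / primitive w b))%:E)%E.
Proof.
move=> hw a0 ab; have b0 := le_lt_trans a0 ab.
set W := primitive w; have Wb := primitive_gt0 hw b0.
have cW : {within `[a, b], continuous W}.
  apply: continuous_subspaceW (primitive_continuous hw (ltW b0)).
  by apply: subset_itvr; rewrite bnd_simp.
have Wr s : a <= s -> s <= b -> 0 <= W s / W b <= 1.
  move=> as_ sb; have s0 : 0 <= s by exact: le_trans as_.
  apply/andP; split.
    apply: divr_ge0; last exact: ltW.
    move: s0; rewrite le_eqVlt => /predU1P[<-|].
      by rewrite /W primitive0.
    by move=> /(primitive_gt0 hw)/ltW.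
  rewrite ler_pdivrMr// mul1r; move: sb; rewrite le_eqVlt => /predU1P[->//|sb].
  exact/ltW/primitive_lt.
have Wr' s : a < s -> s < b -> 0 < W s / W b < 1.
  move=> as_ sb; have s0 : 0 < s by exact: le_lt_trans as_.
  by rewrite divr_gt0 ?primitive_gt0//= ltr_pdivrMr// mul1r primitive_lt// ltW.
have D2 s : a < s -> s < b -> 0 < W b ^+ 2 - W s ^+ 2.
  move=> as_ sb; have s0 : 0 < s by exact: le_lt_trans as_.
  rewrite subr_gt0 ltr_pXn2r ?nnegrE ?ltW ?primitive_gt0//.
  by apply: primitive_lt => //; exact: ltW.
have -> : pi / 2 = asin (W b / W b).
  have := @sinK R (pi / 2); rewrite sin_pihalf divff ?gt_eqF// => -> //.
  rewrite in_itv/= lexx andbT (@le_trans _ _ 0)// ?oppr_le0 divr_ge0// pi_ge0//.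
apply: (@ge0_integral_oo_FTC _ (fun s => w s / Num.sqrt (W b ^+ 2 - W s ^+ 2))
  (fun s => asin (W s / W b))) => //.
- move=> s /andP[as_ sb]; rewrite divr_ge0 ?sqrtr_ge0// ltW//.
  exact/(weight_gt0 hw)/(le_lt_trans a0).
- move=> s; rewrite in_itv/= => /andP[as_ sb].
  have s0 : 0 < s by exact: le_lt_trans as_.
  have ws := is_derive_continuous (is_derive_primitive hw s0).
  have cW2 : {for s, continuous (fun s => W s ^+ 2)}.
    exact: (continuous_comp ws (@exprn_continuous R 2 (W s))).
  apply: (continuous_div_sqrt (weight_continuous hw s0)); last exact: D2.
  by apply: cvgB cW2; exact: cvg_cst.
- move=> s /andP[as_ sb].
  have s0 : 0 < s by exact: le_lt_trans as_.
  have /andP[r0 r1] := Wr' s as_ sb.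
  have dW := is_derive_primitive hw s0.
  have d1 : is_derive s 1 ((W b)^-1 \*: W) ((W b)^-1 *: w s) by exact: is_deriveZ.
  have rE : (W b)^-1 *: W s = W s / W b by rewrite mulrC.
  have d2 : is_derive (((W b)^-1 \*: W) s) 1 (@asin R)
      (Num.sqrt (1 - (W s / W b) ^+ 2))^-1.
    rewrite /= rE; apply: is_derive1_asin.
    by rewrite r1 andbT (lt_trans _ r0).
  have d3 := is_derive1_comp d2 d1.
  have -> : (fun s0 => asin (W s0 / W b)) = @asin R \o ((W b)^-1 \*: W).
    by apply/funext => x /=; rewrite [_ *: _]mulrC.
  have -> : w s / Num.sqrt (W b ^+ 2 - W s ^+ 2) =
      (Num.sqrt (1 - (W s / W b) ^+ 2))^-1 * ((W b)^-1 *: w s).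
    have -> : W b ^+ 2 - W s ^+ 2 = W b ^+ 2 * (1 - (W s / W b) ^+ 2).
      by field; rewrite gt_eqF.
    rewrite sqrtrM ?sqr_ge0// sqrtr_sqr (gtr0_norm Wb) invfM /GRing.scale/=.
    by ring.
  exact: d3.
- apply/subspace_continuousP => s /= sI.
  have cs : {within `[a, b], continuous (fun x => W x / W b)}.
    by move=> x; apply: cvgM; [exact: cW|exact: cvg_cst].
  have asI x : a <= x <= b -> `[(-1 : R), 1]%classic (W x / W b).
    move=> /andP[ax xb]; rewrite /= in_itv/=.
    have /andP[r0 ->] := Wr x ax xb.
    by rewrite (le_trans _ r0).
  apply: (cvg_within_comp (@asin_within_continuous R)).
  - by apply: asI; move: sI; rewrite in_itv.
  - by apply: filterS (withinT _ _) => x /=; rewrite in_itv/=; exact: asI.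
  - by move/subspace_continuousP : cs; exact.
Qed.

(** * The amplitude integral *)

(** To be read with [h = F / G] and [Z = h']. On [(0, m0]] only the sign of [h] is recorded, not
    monotonicity: the levels [h m] with [m0 < m] are positive, hence above [h] there. *)
Record mass_profile (R : realType) (m0 : R) (h Z w : R -> R) : Prop := MassProfile {
  profile_weight : weight_profile w ;
  profile_ge0 : 0 <= m0 ;
  profile_derive : forall s : R, 0 < s -> is_derive s 1 h (Z s) ;
  profile_continuous : forall s : R, 0 < s -> {for s, continuous Z} ;
  profile_derive_gt0 : forall s, m0 < s -> 0 < Z s ;
  profile_le0 : forall s, 0 < s <= m0 -> h s <= 0 ;
  profile_gt0 : forall s, m0 < s -> 0 < h s
}.

(* The function [T(m)] of the header is [travel h w 0 m (h m)]; the interval and the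
   level [y] are decoupled so that the singular end can be split off. *)
Definition travel (R : realType) (h w : R -> R) (a b y : R) : \bar R :=
  (\int[mu]_(s in `]a, b[) (w s / Num.sqrt (y - h s))%:E)%E.

Lemma profile_MVT (R : realType) (f df : R -> R) (a b : R) : a < b ->
  (forall s : R, a <= s <= b -> is_derive s 1 f (df s)) ->
  exists2 c, a < c < b & f b - f a = df c * (b - a).
Proof.
move=> ab dfE; have [||c cI ->] := @MVT _ f df a b ab.
- by move=> x; rewrite in_itv/= => /andP[ax xb]; apply: dfE; rewrite !ltW.
- apply: derivable_within_continuous => x; rewrite in_itv/= => xI.
  by have [] := dfE x xI.
- by exists c => //; move: cI; rewrite in_itv.
Qed.

Section profile.
Variables (R : realType) (m0 : R) (h Z w : R -> R).
Hypothesis hp : mass_profile m0 h Z w.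

Let hw := profile_weight hp.
Let W := primitive w.

Lemma profile_lt s m : m0 < m -> 0 < s < m -> h s < h m.
Proof.
move=> m0m /andP[s0 sm]; have [sm0|m0s] := leP s m0.
  by apply: le_lt_trans (profile_gt0 hp m0m); apply: (profile_le0 hp); rewrite s0.
have [|c /andP[sc cm] E] := @profile_MVT _ h Z s m sm.
  by move=> x /andP[sx _]; apply: (profile_derive hp); exact: lt_le_trans sx.
rewrite -subr_gt0 E mulr_gt0 ?subr_gt0//.
by apply: (profile_derive_gt0 hp); exact: lt_trans sc.
Qed.

Lemma travel_continuous a b y : 0 <= a -> (forall s, a < s < b -> h s < y) ->
  {in `]a, b[, continuous (fun s => w s / Num.sqrt (y - h s))}.
Proof.
move=> a0 hy s; rewrite in_itv/= => sI; have /andP[as_ sb] := sI.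
have s0 : 0 < s by exact: le_lt_trans as_.
apply: (continuous_div_sqrt (weight_continuous hw s0)).
  by apply: cvgB; [exact: cvg_cst|exact: is_derive_continuous (profile_derive hp s0)].
by rewrite subr_gt0 hy.
Qed.

Lemma travel_measurable a b y : 0 <= a -> (forall s, a < s < b -> h s < y) ->
  measurable_fun `]a, b[ (fun s => w s / Num.sqrt (y - h s)).
Proof. by move=> a0 hy; apply: in_continuous_measurable_oo; exact: travel_continuous. Qed.

Lemma travel_integrand_ge0 s y : 0 < s -> 0 <= w s / Num.sqrt (y - h s).
Proof.
by move=> s0; apply: divr_ge0; [exact/ltW/(weight_gt0 hw)|exact: sqrtr_ge0].
Qed.

Lemma travel_ge0 a b y : 0 <= a -> (0 <= travel h w a b y)%E.
Proof.
move=> a0; apply: integral_ge0 => s /=; rewrite in_itv/= lee_fin => /andP[as_ _].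
by apply: travel_integrand_ge0; exact: le_lt_trans as_.
Qed.

Lemma travel_split a m : m0 < m -> 0 < a < m ->
  travel h w 0 m (h m) = (travel h w 0 a (h m) + travel h w a m (h m))%E.
Proof.
move=> m0m aI.
apply: (integral_oo_split (f := fun s => w s / Num.sqrt (h m - h s)) aI).
  by apply: travel_measurable => // s; exact: profile_lt.
by move=> s /andP[s0 _]; exact: travel_integrand_ge0.
Qed.

(** On [(0, a)] the denominator is at least [sqrt (y - h a)], which leaves the integral of [w]. The
    bound is small when [y] is large. *)
Lemma travel_head_bound a y : 0 < a -> (forall s, 0 < s < a -> h s <= h a) -> h a < y ->
  (travel h w 0 a y <= (W a / Num.sqrt (y - h a))%:E)%E.
Proof.
move=> a0 ha hay.
have D : 0 < y - h a by rewrite subr_gt0.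
have mw : measurable_fun `]0, a[ w.
  by apply: in_continuous_measurable_oo; exact: in_continuous_weight.
apply: (le_trans (le_integral_oo (g := fun s => (Num.sqrt (y - h a))^-1 * w s) _ _ _)).
- apply: travel_measurable => // s sI.
  exact: le_lt_trans (ha s sI) hay.
- exact: measurable_funM.
- move=> s sI; have /andP[s0 _] := sI.
  rewrite travel_integrand_ge0//= mulrC ler_wpM2r//; first exact/ltW/(weight_gt0 hw).
  have has := ha s sI.
  rewrite lef_pV2 ?posrE ?sqrtr_gt0//; last by lra.
  by rewrite ler_wsqrtr// lerB.
rewrite integral_oo_scale ?invr_ge0 ?sqrtr_ge0//; last first.
  by move=> s /andP[s0 _]; exact/ltW/(weight_gt0 hw).
by rewrite integral_primitive// primitive0 subr0 -EFinM mulrC.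
Qed.

(** With [z = min Z] on [[a0, b0]] the mean value theorem gives [h m - h s >= z (m - s)], so the
    integrand is at most [B / sqrt (m - s)] with [B = max w / sqrt z]; integrating produces the
    factor [2]. The constant is uniform in [a] and [m], as the passages to the limit require. *)
Lemma travel_tail_bound a0 b0 : 0 < a0 -> a0 < b0 ->
  (forall s, a0 <= s <= b0 -> 0 < Z s) ->
  exists2 C, 0 <= C & forall a m, a0 <= a -> a < m -> m <= b0 ->
    (travel h w a m (h m) <= (C * Num.sqrt (m - a))%:E)%E.
Proof.
move=> a00 ab Z0.
have pos s : s \in `[a0, b0] -> 0 < s.
  by rewrite in_itv/= => /andP[as_ _]; exact: lt_le_trans as_.
have cZ : {within `[a0, b0], continuous Z}.
  apply: continuous_in_subspaceT => s; rewrite inE/= => /pos.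
  exact: (profile_continuous hp).
have cw : {within `[a0, b0], continuous w}.
  apply: continuous_in_subspaceT => s; rewrite inE/= => /pos.
  exact: (weight_continuous hw).
have [z zI zmin] := EVT_min (ltW ab) cZ.
have [x xI xmax] := EVT_max (ltW ab) cw.
have Zz : 0 < Z z by apply: Z0; move: zI; rewrite in_itv.
have wx : 0 < w x by apply: (weight_gt0 hw); exact: pos.
pose B := w x / Num.sqrt (Z z).
have B0 : 0 < B by rewrite divr_gt0// sqrtr_gt0.
exists (B * 2); first by rewrite mulr_ge0// ltW.
move=> a m a0a am mb0.
have a0_ : 0 <= a by rewrite ltW// (lt_le_trans a00).
have hlow s : a < s < m -> Z z * (m - s) <= h m - h s.
  move=> /andP[as_ sm]; have [|c /andP[sc cm] ->] := @profile_MVT _ h Z s m sm.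
    by move=> t /andP[st _]; apply: (profile_derive hp); lra.
  apply: ler_wpM2r; first by rewrite subr_ge0 ltW.
  apply: zmin; rewrite in_itv/=.
  by apply/andP; split; lra.
have Zm s : a < s < m -> 0 < Z z * (m - s).
  by move=> /andP[_ sm]; rewrite mulr_gt0// subr_gt0.
have gm : {in `]a, m[, continuous (fun s => B / Num.sqrt (m - s))}.
  move=> s; rewrite in_itv/= => /andP[as_ sm].
  apply: (@continuous_div_sqrt _ (cst B) (fun s => m - s)).
  - exact: cvg_cst.
  - by apply: cvgB; [exact: cvg_cst|exact: cvg_id].
  - by rewrite subr_gt0.
have -> : B * 2 * Num.sqrt (m - a) =
    - (B * 2) * Num.sqrt (m - m) - - (B * 2) * Num.sqrt (m - a).
  by rewrite subrr sqrtr0 mulr0 sub0r mulNr opprK.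
apply: (le_trans (le_integral_oo (g := fun s => B / Num.sqrt (m - s)) _ _ _)).
- apply: travel_measurable => // s sI.
    by have := hlow s sI; have := Zm s sI; lra.
- exact: in_continuous_measurable_oo.
- move=> s sI; have /andP[as_ sm] := sI.
    rewrite (travel_integrand_ge0 _ (le_lt_trans a0_ as_))/=.
    rewrite /B -mulrA -invfM -sqrtrM ?(ltW Zz)//.
    apply: ler_pM; rewrite ?invr_ge0 ?sqrtr_ge0//.
    * by apply/ltW/(weight_gt0 hw); lra.
    * by apply: xmax; rewrite in_itv/=; apply/andP; split; lra.
    * have := hlow s sI; have := Zm s sI => Z1 Z2.
      rewrite lef_pV2 ?posrE ?sqrtr_gt0//; last by lra.
      by rewrite ler_wsqrtr.
rewrite le_eqVlt; apply/orP; left; apply/eqP.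
apply: (@ge0_integral_oo_FTC _ (fun s => B / Num.sqrt (m - s))
  (fun s => - (B * 2) * Num.sqrt (m - s))) => [//| |//| |].
- by move=> s /andP[as_ sm]; rewrite divr_ge0 ?sqrtr_ge0// ltW.
- move=> s /andP[as_ sm].
  have sm0 : 0 < m - s by rewrite subr_gt0.
  have d1 : is_derive s 1 (fun s : R => m - s) (0 - 1).
    by apply: is_deriveB.
  have d2 := @is_derive1_comp R Num.sqrt (fun s : R => m - s) s _ _
    (is_derive1_sqrt sm0) d1.
  have d3 : is_derive s 1 (- (B * 2) \*: (Num.sqrt \o (fun s : R => m - s)))
     (- (B * 2) *: ((2 * Num.sqrt (m - s))^-1 * (0 - 1))) by exact: is_deriveZ.
  have -> : B / Num.sqrt (m - s) =
      - (B * 2) *: ((2 * Num.sqrt (m - s))^-1 * (0 - 1)).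
    by rewrite /GRing.scale/=; field; rewrite gt_eqF// sqrtr_gt0.
  exact: d3.
- apply: continuous_subspaceT => s; apply: cvgMr.
  apply: (continuous_comp (f := fun s : R => m - s)); last exact: sqrt_continuous.
  by apply: cvgB; [exact: cvg_cst|exact: cvg_id].
Qed.
End profile.

(** * Continuity in the amplitude and comparison with the arcsine *)

Section comparison.
Variables (R : realType) (m0 : R) (h Z w : R -> R).
Hypothesis hp : mass_profile m0 h Z w.

Let hw := profile_weight hp.
Let W := primitive w.
Let m0_ge0 := profile_ge0 hp.

Lemma travel_head_fin a y : m0 < a -> h a < y ->
  travel h w 0 a y \is a fin_num.
Proof.
move=> m0a hay; have a0 := le_lt_trans m0_ge0 m0a.
rewrite ge0_fin_numE ?(travel_ge0 hp)//.
apply: le_lt_trans (travel_head_bound hp a0 _ hay) (ltry _).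
by move=> s sI; exact/ltW/(profile_lt hp m0a).
Qed.

Lemma travel_tail_fin a m : m0 < a -> a < m -> travel h w a m (h m) \is a fin_num.
Proof.
move=> m0a am; have a0 := le_lt_trans m0_ge0 m0a.
rewrite ge0_fin_numE ?(travel_ge0 hp) ?(ltW a0)//.
have [|C _ CP] := travel_tail_bound hp a0 am.
  by move=> s /andP[as_ _]; apply: (profile_derive_gt0 hp); exact: lt_le_trans as_.
exact: le_lt_trans (CP a m (lexx _) am (lexx _)) (ltry _).
Qed.

Lemma travel_fin m : m0 < m -> travel h w 0 m (h m) \is a fin_num.
Proof.
move=> m0m; pose a := (m0 + m) / 2.
have m0a : m0 < a by rewrite /a; lra.
have am : a < m by rewrite /a; lra.
rewrite (travel_split hp m0m (a := a)) ?(le_lt_trans m0_ge0 m0a)//.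
rewrite fin_numD travel_tail_fin// travel_head_fin//.
by apply: (profile_lt hp m0m); rewrite (le_lt_trans m0_ge0 m0a).
Qed.

Lemma travel_head_continuous a y : m0 < a -> h a < y ->
  {for y, continuous (fun y => fine (travel h w 0 a y))}.
Proof.
move=> m0a hay; have a0 := le_lt_trans m0_ge0 m0a.
(* Levels above [y0] stay away from [h a], so one multiple of [w] dominates all the integrands and
   continuity under the integral sign applies. *)
pose y0 := (h a + y) / 2.
have y0a : h a < y0 by rewrite /y0; lra.
have hs s : 0 < s < a -> h s < h a by exact: (profile_lt hp m0a).
have yI : y \in `]y0, (y + 1)[%classic.
  by rewrite inE/= in_itv/=; apply/andP; split; rewrite /y0; lra.
have mt x : y0 < x -> measurable_fun `]0, a[ (fun s => w s / Num.sqrt (x - h s)).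
  move=> xy; apply: (travel_measurable hp) => // s /hs; lra.
pose g s := (Num.sqrt (y0 - h a))^-1 * w s.
have gi : mu.-integrable `]0, a[ (EFin \o g).
  exact: integrable_scale (weight_integrable hw a).
have fg x s : y0 < x -> 0 < s < a -> `|w s / Num.sqrt (x - h s)| <= g s.
  move=> xy sI; have /andP[s0 sa] := sI.
  rewrite ger0_norm ?(travel_integrand_ge0 hp)// mulrC.
  apply: ler_wpM2r; first exact/ltW/(weight_gt0 hw).
  have := hs s sI => hsa.
  rewrite lef_pV2 ?posrE ?sqrtr_gt0; [|by lra..].
  by apply: ler_wsqrtr; lra.
suff K : {in `]y0, (y + 1)[%classic, continuous (fun l =>
    (\int[mu]_(s in `]0, a[) (w s / Num.sqrt (l - h s)))%R)} by exact: K yI.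
apply: (continuity_under_integral _ _ _ gi) => //.
- move=> x /=; rewrite in_itv/= => /andP[y0x _].
  apply: (le_integrable _ _ _ gi) => //.
    by apply/measurable_EFinP; exact: mt.
  move=> s /=; rewrite in_itv/= => sI; rewrite lee_fin.
  exact: le_trans (fg x s y0x sI) (ler_norm _).
- apply: aeW => s /=; rewrite in_itv/= => sI x; rewrite inE/= in_itv/= => /andP[y0x _].
  apply: (@continuous_div_sqrt _ (cst (w s)) (fun x => x - h s)).
  + exact: cvg_cst.
  + by apply: cvgB; [exact: cvg_id|exact: cvg_cst].
  + by have := hs s sI; lra.
- move=> x /=; rewrite in_itv/= => /andP[y0x _]; apply: aeW => s /=.
  by rewrite in_itv/=; exact: fg.
Qed.

(** Interval and level move together with [m]. Cutting at a fixed [a] slightly below [m] leaves a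
    head in which only the level moves, and a tail that is uniformly small for all amplitudes near
    [m]. *)
Lemma travel_cvg m : m0 < m ->
  {for m, continuous (fun m => fine (travel h w 0 m (h m)))}.
Proof.
move=> m0m; have m_gt0 := le_lt_trans m0_ge0 m0m.
pose a0 := (m0 + m) / 2.
have m0a0 : m0 < a0 by rewrite /a0; lra.
have a00 := le_lt_trans m0_ge0 m0a0.
have [||C C0 CP] := @travel_tail_bound _ _ _ _ _ hp a0 (m + 1) a00.
- by rewrite /a0; lra.
- by move=> s /andP[as_ _]; apply: (profile_derive_gt0 hp); exact: lt_le_trans as_.
apply/cvgrPdist_lt => e e0.
(* [C + 1] avoids a division by [0]. Amplitudes within [d] of [m] are at distance less than
   [2 * d <= k ^+ 2] from [a = m - d], so each tail is at most [C * k < e / 3]. *)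
pose k := e / (3 * (C + 1)).
have C1 : 0 < C + 1 by rewrite ltr_wpDl.
have k0 : 0 < k by rewrite divr_gt0// mulr_gt0.
have Ck : C * k < e / 3.
  have -> : e / 3 = (C + 1) * k by rewrite /k; field; rewrite gt_eqF.
  by rewrite ltr_pM2r// ltrDl.
pose d := Num.min ((m - a0) / 2) (k ^+ 2 / 2).
have d0 : 0 < d by rewrite lt_min !divr_gt0 ?exprn_gt0// subr_gt0 /a0; lra.
have d1 : d <= (m - a0) / 2 by rewrite ge_min lexx.
have d2 : 2 * d <= k ^+ 2.
  have : d <= k ^+ 2 / 2 by rewrite ge_min lexx orbT.
  by lra.
pose a := m - d.
have a0m : a0 < m by rewrite /a0; lra.
have a0a : a0 <= a by rewrite /a; lra.
have am : a < m by rewrite /a; lra.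
have m0a : m0 < a by exact: lt_le_trans a0a.
have a_gt0 : 0 < a by exact: lt_le_trans a0a.
have tail x : a < x -> x < m + d -> x <= m + 1 ->
    exists2 t, 0 <= t < e / 3 &
    fine (travel h w 0 x (h x)) = fine (travel h w 0 a (h x)) + t.
  move=> ax xmd xm1; have m0x := lt_trans m0a ax.
  have hax : h a < h x by apply: (profile_lt hp m0x); rewrite a_gt0.
  exists (fine (travel h w a x (h x))); last first.
    rewrite (travel_split hp m0x (a := a)) ?a_gt0// fineD//.
      exact: travel_head_fin.
    exact: travel_tail_fin.
  rewrite fine_ge0 ?(travel_ge0 hp) ?(ltW a_gt0)//=.
  apply: le_lt_trans Ck.
  rewrite -lee_fin fineK; last exact: travel_tail_fin.
  apply: (le_trans (CP a x a0a ax xm1)); rewrite lee_fin ler_wpM2l//.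
  rewrite -[leRHS](ger0_norm (ltW k0)) -sqrtr_sqr ler_wsqrtr//.
  by apply: le_trans d2; rewrite /a; lra.
have ch : {for m, continuous h}.
  exact: is_derive_continuous (profile_derive hp m_gt0).
have hay : h a < h m by apply: (profile_lt hp m0m); rewrite a_gt0.
have cH : {for m, continuous (fun x => fine (travel h w 0 a (h x)))}.
  exact: (continuous_comp ch (travel_head_continuous m0a hay)).
have e3 : 0 < e / 3 by rewrite divr_gt0.
move/cvgrPdist_lt : cH => /(_ _ e3) cH.
have d4 : 0 < Num.min d 1 by rewrite lt_min d0 ltr01.
near=> x.
have xm : `|m - x| < Num.min d 1.
  by near: x; have /cvgrPdist_lt := @cvg_id _ (nbhs m); exact.
move: xm; rewrite lt_min !ltr_norml => /andP[/andP[xd1 xd2] /andP[x11 x12]].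
have [|||tm /andP[tm0 tm1] ->] := tail m; [by []|by lra|by lra|].
have [|||tx /andP[tx0 tx1] ->] := tail x; [by rewrite /a; lra|by lra|by lra|].
have : `|fine (travel h w 0 a (h m)) - fine (travel h w 0 a (h x))| < e / 3.
  by near: x.
rewrite !ltr_norml => /andP[H1 H2].
by apply/andP; split; lra.
Unshelve. all: by end_near. Qed.

Lemma is_derive_primitive_sqr (s : R) : 0 < s ->
  is_derive s 1 (fun x : R => W x ^+ 2) (2 * W s * w s).
Proof.
move=> s0; have dW := is_derive_primitive hw s0.
have d2 := is_deriveM dW dW.
have -> : (fun x => W x ^+ 2) = (W * W : R -> R).
  by apply/funext => x; rewrite expr2.
have -> : 2 * W s * w s = W s *: w s + W s *: w s.
  by rewrite /GRing.scale/=; ring.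
exact: d2.
Qed.

Lemma primitive_sqr_gt (a m s : R) : 0 <= a -> a < s -> s < m -> 0 < W m ^+ 2 - W s ^+ 2.
Proof.
move=> a0 as_ sm; have s0 : 0 < s by exact: le_lt_trans as_.
rewrite subr_gt0 ltr_pXn2r ?nnegrE//; last 2 first.
- exact/ltW/primitive_gt0.
- exact/ltW/primitive_gt0/(lt_trans s0).
by apply: primitive_lt => //; exact: ltW.
Qed.

Lemma arcsine_measurable (a m : R) : 0 <= a ->
  measurable_fun `]a, m[ (fun s => w s / Num.sqrt (W m ^+ 2 - W s ^+ 2)).
Proof.
move=> a0; apply: in_continuous_measurable_oo => s; rewrite in_itv/= => /andP[as_ sm].
have s0 : 0 < s by exact: le_lt_trans as_.
apply: (continuous_div_sqrt (weight_continuous hw s0)).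
  by apply: cvgB; [exact: cvg_cst|exact: is_derive_continuous (is_derive_primitive_sqr s0)].
exact: primitive_sqr_gt as_ sm.
Qed.

Lemma arcsine_ge0 (a m s : R) : 0 <= a -> a < s ->
  0 <= w s / Num.sqrt (W m ^+ 2 - W s ^+ 2).
Proof.
move=> a0 as_; apply: divr_ge0; last exact: sqrtr_ge0.
by apply/ltW/(weight_gt0 hw); exact: le_lt_trans as_.
Qed.

Lemma integral_scaled_arcsine (a m c : R) : 0 < c -> 0 <= a -> a < m ->
  (\int[mu]_(s in `]a, m[)
     ((Num.sqrt c)^-1 * (w s / Num.sqrt (W m ^+ 2 - W s ^+ 2)))%:E =
   ((pi / 2 - asin (W a / W m)) / Num.sqrt c)%:E)%E.
Proof.
move=> c0 a0 am.
rewrite integral_oo_scale ?invr_ge0 ?sqrtr_ge0//; last 2 first.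
- exact: arcsine_measurable.
- by move=> s /andP[as_ _]; exact: arcsine_ge0 as_.
by rewrite integral_arcsine// -EFinM mulrC.
Qed.

(** The mean value theorem for [c W^2 - h]: the sign of [c Phi' - Z] on [(a, m)] orders the two
    quantities under the square roots. Both comparisons below rest on it. *)
Lemma scaled_MVT (a m c s : R) : 0 <= a -> a < s -> s < m ->
  exists2 x, a < x < m & c * (W m ^+ 2 - W s ^+ 2) - (h m - h s) =
    (c * (2 * W x * w x) - Z x) * (m - s).
Proof.
move=> a0 as_ sm.
have [|x /andP[sx xm] E] := @profile_MVT _ (fun x => c * W x ^+ 2 - h x)
    (fun x => c * (2 * W x * w x) - Z x) s m sm.
  move=> x /andP[sx _].
  have x0 : 0 < x by apply: lt_le_trans sx; exact: le_lt_trans as_.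
  have d1 : is_derive x 1 (c \*: (fun x => W x ^+ 2)) (c *: (2 * W x * w x)).
    by have := is_derive_primitive_sqr x0 => ?; exact: is_deriveZ.
  have d2 := profile_derive hp x0.
  exact: is_deriveB d1 d2.
exists x; first by rewrite (lt_trans as_ sx).
by rewrite -E; ring.
Qed.

Lemma travel_lower c a m : 0 < c -> 0 <= a -> a < m -> m0 < m ->
  (forall s, a < s < m -> Z s <= c * (2 * W s * w s)) ->
  (((pi / 2 - asin (W a / W m)) / Num.sqrt c)%:E <= travel h w a m (h m))%E.
Proof.
move=> c0 a0 am m0m Zle; rewrite -integral_scaled_arcsine//.
have hlt s : a < s < m -> h s < h m.
  by move=> /andP[as_ sm]; apply: (profile_lt hp m0m); rewrite sm (le_lt_trans a0).
apply: le_integral_oo.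
- by apply: measurable_funM => //; exact: arcsine_measurable.
- exact: (travel_measurable hp).
- move=> s sI; have /andP[as_ sm] := sI; apply/andP; split.
    by rewrite mulr_ge0 ?invr_ge0 ?sqrtr_ge0//; exact: arcsine_ge0 as_.
  have D := primitive_sqr_gt a0 as_ sm.
  rewrite mulrCA -invfM -sqrtrM ?(ltW c0)//.
  apply: ler_wpM2l; first by apply/ltW/(weight_gt0 hw); exact: le_lt_trans as_.
  have [x xI E] := scaled_MVT c a0 as_ sm.
  have h1 := hlt s sI; have h2 := Zle x xI.
  have h3 : 0 <= (c * (2 * W x * w x) - Z x) * (m - s).
    by rewrite mulr_ge0// subr_ge0// ltW.
  rewrite lef_pV2 ?posrE ?sqrtr_gt0 ?subr_gt0 ?mulr_gt0//.
  by apply: ler_wsqrtr; lra.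
Qed.

Lemma travel_upper c a m : 0 < c -> 0 <= a -> a < m -> m0 < m ->
  (forall s, a < s < m -> c * (2 * W s * w s) <= Z s) ->
  (travel h w a m (h m) <= ((pi / 2 - asin (W a / W m)) / Num.sqrt c)%:E)%E.
Proof.
move=> c0 a0 am m0m Zge; rewrite -integral_scaled_arcsine//.
have hlt s : a < s < m -> h s < h m.
  by move=> /andP[as_ sm]; apply: (profile_lt hp m0m); rewrite sm (le_lt_trans a0).
apply: le_integral_oo.
- exact: (travel_measurable hp).
- by apply: measurable_funM => //; exact: arcsine_measurable.
- move=> s sI; have /andP[as_ sm] := sI; apply/andP; split.
    by apply: (travel_integrand_ge0 hp); exact: le_lt_trans as_.
  have D := primitive_sqr_gt a0 as_ sm.
  rewrite mulrCA -invfM -sqrtrM ?(ltW c0)//.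
  apply: ler_wpM2l; first by apply/ltW/(weight_gt0 hw); exact: le_lt_trans as_.
  have [x xI E] := scaled_MVT c a0 as_ sm.
  have h1 := hlt s sI; have h2 := Zge x xI.
  have h3 : (c * (2 * W x * w x) - Z x) * (m - s) <= 0.
    by rewrite mulr_le0_ge0 ?subr_le0// subr_ge0 ltW.
  rewrite lef_pV2 ?posrE ?sqrtr_gt0 ?subr_gt0 ?mulr_gt0//.
  by apply: ler_wsqrtr; lra.
Qed.

End comparison.

(** * Amplitudes close to m_0 *)

Section threshold.
Variables (R : realType) (m0 : R) (h Z w : R -> R).
Hypothesis hp : mass_profile m0 h Z w.
Hypothesis m0_gt0 : 0 < m0.

Let hw := profile_weight hp.
Let mm (n : nat) : R := m0 + n.+1%:R^-1.

Lemma threshold_seq_gt n : m0 < mm n.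
Proof. by rewrite ltrDl invr_gt0. Qed.

Lemma threshold_seq_cvg : mm n @[n --> \oo] --> m0.
Proof.
rewrite -[X in _ --> X]addr0; apply: cvgD; first exact: cvg_cst.
exact: cvg_harmonic.
Qed.

Lemma profile_threshold : h m0 = 0.
Proof.
apply/eqP; rewrite eq_le (profile_le0 hp) ?m0_gt0 ?lexx//=.
have ch : h x @[x --> m0] --> h m0.
  exact: is_derive_continuous (profile_derive hp m0_gt0).
have hm : h (mm n) @[n --> \oo] --> h m0 by exact: (cvg_comp _ _ threshold_seq_cvg ch).
rewrite -(cvg_lim _ hm)//; apply: limr_ge; first by apply/cvg_ex; exists (h m0).
by apply: nearW => n; apply/ltW/(profile_gt0 hp); exact: threshold_seq_gt.
Qed.

Lemma threshold_value_cvg : h (mm n) @[n --> \oo] --> 0.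
Proof.
rewrite -profile_threshold; apply: (cvg_comp _ _ threshold_seq_cvg).
exact: is_derive_continuous (profile_derive hp m0_gt0).
Qed.

(** At zeros of [h] the integrands tend to [+oo], in agreement with the convention for the integrand
    of [IF]. *)
Lemma threshold_integrand_cvg s : 0 < s <= m0 ->
  ((w s / Num.sqrt (h (mm n) - h s))%:E @[n --> \oo] -->
   (w s)%:E / (Num.sqrt (- h s))%:E)%E.
Proof.
move=> sI; have hs := profile_le0 hp sI; have /andP[s0 _] := sI.
have ws := weight_gt0 hw s0.
move: hs; rewrite le_eqVlt => /predU1P[hs0|hs].
- rewrite hs0 oppr0 sqrtr0 inve0 gt0_muley ?lte_fin//.
  apply/cvgeryP/cvgryPge => A.
  (* [A] may be nonpositive; the maximum is a positive target by which one can divide. *)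
  have A0 : 0 < Num.max A 1 by rewrite lt_max ltr01 orbT.
  have e0 : 0 < (w s / Num.max A 1) ^+ 2 by apply: exprn_gt0; exact: divr_gt0.
  near=> n.
  have hn : h (mm n) <= (w s / Num.max A 1) ^+ 2.
    near: n; move/cvgrPdist_le : threshold_value_cvg => /(_ _ e0); apply: filterS => n.
    by rewrite sub0r normrN; exact: le_trans (ler_norm _).
  have hn0 : 0 < h (mm n) by apply: (profile_gt0 hp); exact: threshold_seq_gt.
  rewrite addr0 (@le_trans _ _ (Num.max A 1)) ?le_max ?lexx//.
  rewrite ler_pdivlMr ?sqrtr_gt0// mulrC -ler_pdivlMr//.
  rewrite -[leRHS]gtr0_norm ?divr_gt0// -sqrtr_sqr.
  exact: ler_wsqrtr.
- have D : 0 < - h s by rewrite oppr_gt0.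
  rewrite inver gt_eqF ?sqrtr_gt0// -EFinM.
  apply: cvg_EFin; first exact: nearW.
  have c1 : h (mm n) - h s @[n --> \oo] --> - h s.
    rewrite -[X in _ --> X]add0r; apply: cvgB; last exact: cvg_cst.
    exact: threshold_value_cvg.
  have c2 := cvg_comp _ _ c1 (@sqrt_continuous R (- h s)).
  apply: cvgM; first exact: cvg_cst.
  by apply: cvgV c2; rewrite gt_eqF// sqrtr_gt0.
Unshelve. all: by end_near. Qed.

(** As [n] grows the level [h (mm n)] decreases, so the integrands on the fixed interval increase.
    Monotone convergence applies even if the limit is [+oo]. *)
Lemma threshold_sup :
  (\int[mu]_(s in `]0%R, m0]) ((w s)%:E / (Num.sqrt (- h s))%:E) =
   ereal_sup (range (fun n => travel h w 0 m0 (h (mm n)))))%E.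
Proof.
pose g n s := ((w s / Num.sqrt (h (mm n) - h s))%:E)%E.
have hlt n s : 0 < s <= m0 -> h s < h (mm n).
  move=> sI; apply: le_lt_trans (profile_le0 hp sI) _.
  by apply: (profile_gt0 hp); exact: threshold_seq_gt.
have mt n : measurable_fun `]0, m0[ (fun s => w s / Num.sqrt (h (mm n) - h s)).
  apply: (travel_measurable hp) => // s /andP[s0 sm]; apply: hlt.
  by rewrite s0 ltW.
have mg n : measurable_fun `]0, m0] (g n).
  by apply/measurable_EFinP; apply: measurable_fun_itv_oc (mt n).
have hmono n k : (n <= k)%N -> h (mm k) <= h (mm n).
  rewrite leq_eqVlt => /predU1P[->//|nk].
  apply/ltW/(profile_lt hp); first exact: threshold_seq_gt.
  rewrite (lt_trans m0_gt0 (threshold_seq_gt k))/= ltrD2l.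
  by rewrite ltf_pV2 ?posrE// ltr_nat.
have gE n : (\int[mu]_(s in `]0%R, m0]) g n s = travel h w 0 m0 (h (mm n)))%E.
  by rewrite -integral_itv_bndo_bndc//; exact/measurable_EFinP.
have mono s : `]0, m0]%classic s -> {homo g^~ s : n k / (n <= k)%N >-> (n <= k)%E}.
  rewrite /= in_itv/= => sI n k nk; have /andP[s0 _] := sI; rewrite lee_fin.
  apply: ler_wpM2l; first exact/ltW/(weight_gt0 hw).
  rewrite lef_pV2 ?posrE ?sqrtr_gt0 ?subr_gt0 ?hlt//.
  by rewrite ler_wsqrtr// lerB// hmono.
have g0 n s : `]0, m0]%classic s -> (0 <= g n s)%E.
  rewrite /= in_itv/= => /andP[s0 _]; rewrite lee_fin.
  exact: (travel_integrand_ge0 hp).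
have C1 : (\int[mu]_(s in `]0%R, m0]) g n s @[n --> \oo] -->
    \int[mu]_(s in `]0%R, m0]) limn (g^~ s))%E.
  by apply: cvg_monotone_convergence => //.
have C2 : (\int[mu]_(s in `]0%R, m0]) g n s @[n --> \oo] -->
    ereal_sup (range (fun n => \int[mu]_(s in `]0%R, m0]) g n s)))%E.
  apply: ereal_nondecreasing_cvgn => n k nk; apply: ge0_le_integral => //.
    by move=> s sI; exact: g0.
  - exact: mg.
  - exact: mg.
  - by move=> s sI; exact: (mono s sI n k nk).
have -> : (fun n => travel h w 0 m0 (h (mm n))) =
    (fun n => \int[mu]_(s in `]0%R, m0]) g n s)%E.
  by apply/funext => n; rewrite gE.
rewrite -(cvg_unique _ C1 C2)//.
apply: eq_integral => s; rewrite inE/= in_itv/= => sI.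
by apply/esym/cvg_lim => //; exact: threshold_integrand_cvg.
Qed.

(** A lower bound for [T] may discard the piece over [(m0, m)], so nothing is required of [Z] at
    [m0]. *)
Lemma travel_above_threshold (r : \bar R) :
  (r < \int[mu]_(s in `]0%R, m0]) ((w s)%:E / (Num.sqrt (- h s))%:E))%E ->
  exists2 m, m0 < m & (r < travel h w 0 m (h m))%E.
Proof.
rewrite threshold_sup => /ereal_sup_gt[_ [n _ <-] rn].
exists (mm n); first exact: threshold_seq_gt.
have mI : 0 < m0 < mm n by rewrite m0_gt0 threshold_seq_gt.
apply: lt_le_trans rn _; rewrite (travel_split hp (threshold_seq_gt n) mI).
by rewrite leeDl// (travel_ge0 hp)// ltW.
Qed.

(** Here the piece over [(m0, m)] has to vanish in the limit. [0 < Z m0] makes [Z] positive on the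
    closed interval [[m0, m0 + 1]], so the tail bound holds with [a = m0]. *)
Lemma travel_below_threshold (r : R) : 0 < Z m0 ->
  (\int[mu]_(s in `]0%R, m0]) ((w s)%:E / (Num.sqrt (- h s))%:E) < r%:E)%E ->
  exists2 m, m0 < m & (travel h w 0 m (h m) < r%:E)%E.
Proof.
move=> Z0; rewrite threshold_sup; set I := ereal_sup _ => Ir.
have Ile n : (travel h w 0 m0 (h (mm n)) <= I)%E.
  by apply: ereal_sup_ubound; exists n.
have I0 : (0 <= I)%E by apply: le_trans (Ile 0%N); exact: (travel_ge0 hp).
have Ifin : I \is a fin_num by rewrite ge0_fin_numE// (lt_trans Ir) ?ltry.
have m1 : m0 < m0 + 1 by rewrite ltrDl.
have [|C C0 CP] := travel_tail_bound hp m0_gt0 m1.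
  move=> s /andP[ms _]; move: ms; rewrite le_eqVlt => /predU1P[<-//|].
  exact: (profile_derive_gt0 hp).
have rI : 0 < r - fine I by rewrite subr_gt0 -lte_fin fineK.
have : (C * Num.sqrt (mm n - m0)) @[n --> \oo] --> 0.
  rewrite -(mulr0 C); apply: cvgMr; rewrite -(sqrtr0 R).
  have c1 : mm n - m0 @[n --> \oo] --> 0.
    by rewrite -(subrr m0); apply: cvgB (threshold_seq_cvg) _; exact: cvg_cst.
  exact: (cvg_comp _ _ c1 (@sqrt_continuous R 0)).
move/cvgrPdist_lt => /(_ _ rI)[n _ /(_ n (leqnn n))] /=.
rewrite sub0r normrN => hn.
exists (mm n); first exact: threshold_seq_gt.
have mn1 : mm n <= m0 + 1.
  by rewrite lerD2l invf_le1// ler1n.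
have mI : 0 < m0 < mm n by rewrite m0_gt0 threshold_seq_gt.
rewrite (travel_split hp (threshold_seq_gt n) mI).
have := leeD (Ile n) (CP m0 (mm n) (lexx _) (threshold_seq_gt n) mn1).
move=> /le_lt_trans; apply.
rewrite -(fineK Ifin) -EFinD lte_fin.
have := le_lt_trans (ler_norm _) hn; lra.
Qed.

End threshold.

(** * Asymptotics and the intermediate value theorem *)

Lemma primitive_cvgy (R : realType) (w : R -> R) : weight_profile w ->
  (\int[mu]_(s in `]0%R, +oo[) (w s)%:E = +oo)%E ->
  primitive w x @[x --> +oo] --> +oo.
Proof.
move=> hw wy; apply/cvgryPge => A.
have mw : measurable_fun (`]0, +oo[%classic : set R) w.
  apply: open_continuous_measurable_fun => //.
  by move=> s; rewrite inE/= in_itv/= andbT; exact: weight_continuous.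
have C : (\int[mu]_(s in `]0%R, (0 + n%:R)%R]) (w s)%:E @[n --> \oo] --> +oo)%E.
  rewrite -wy itv_bndy_bigcup_BRight.
  apply: ge0_nondecreasing_set_cvg_integral => //.
  - move=> n k nk; apply/subsetPset; apply: subset_itvl.
    by rewrite bnd_simp lerD2l ler_nat.
  - move=> n; apply/measurable_EFinP; apply: measurable_funS mw => //.
    exact: subset_itvl.
  - move=> n s /=; rewrite in_itv/= lee_fin => /andP[s0 _].
    exact/ltW/(weight_gt0 hw).
(* The successor makes the endpoint positive, as [integral_primitive] requires. *)
move/cvgeyPge : C => /(_ A)[n _ /(_ n.+1 (leqnSn n))] /=.
have n0 : 0 < n.+1%:R :> R by rewrite ltr0n.
rewrite add0r -integral_itv_bndo_bndc; last first.
  by apply/measurable_EFinP; apply: measurable_funS mw => //; exact: subset_itvl.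
rewrite integral_primitive// primitive0 subr0 lee_fin => An.
exists n.+1%:R; split; first exact: num_real.
move=> x nx; apply: (le_trans An); apply/ltW/primitive_lt => //; exact: ltW.
Qed.

Section asymptotics.
Variables (R : realType) (m0 : R) (h Z w : R -> R).
Hypothesis hp : mass_profile m0 h Z w.

Let hw := profile_weight hp.
Let W := primitive w.
Let m0_ge0 := profile_ge0 hp.
Let T m := travel h w 0 m (h m).

Lemma travel_IVT (a b r : R) : m0 < a -> m0 < b ->
  (T a <= r%:E)%E -> (r%:E <= T b)%E -> exists2 m, m0 < m & T m = r%:E.
Proof.
move=> m0a m0b Ta Tb.
pose f m := fine (T m).
have TE m : m0 < m -> T m = (f m)%:E by move=> m0m; rewrite fineK// (travel_fin hp).
have fa : f a <= r by rewrite -lee_fin -TE.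
have fb : r <= f b by rewrite -lee_fin -TE.
have cf x : m0 < x -> {for x, continuous f} by exact: (travel_cvg hp).
have cfab x y : m0 < x -> {within `[x, y], continuous f}.
  move=> m0x; apply: continuous_in_subspaceT => z; rewrite inE/= in_itv/= => /andP[xz _].
  by apply: cf; exact: lt_le_trans xz.
have [ab|/ltW ba] := leP a b.
- have [|m mI fm] := IVT ab (cfab a b m0a) (v := r).
    by rewrite ge_min le_max fa fb orbT.
  have m0m : m0 < m.
    by move: mI; rewrite in_itv/= => /andP[am _]; exact: lt_le_trans am.
  by exists m => //; rewrite TE// fm.
- have [|m mI fm] := IVT ba (cfab b a m0b) (v := r).
    by rewrite ge_min le_max fa fb orbT.
  have m0m : m0 < m.
    by move: mI; rewrite in_itv/= => /andP[am _]; exact: lt_le_trans am.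
  by exists m => //; rewrite TE// fm.
Qed.

Let asin0 : asin (0 : R) = 0.
Proof.
have := @sinK R 0; rewrite sin0; apply.
by rewrite in_itv/= oppr_le0 divr_ge0// pi_ge0.
Qed.

Lemma asin_primitive_cvg0 a : W x @[x --> +oo] --> +oo ->
  asin (W a / W x) @[x --> +oo] --> 0.
Proof.
move=> Wy; rewrite -[X in _ --> X]asin0.
have c0 : W a / W x @[x --> +oo] --> 0.
  rewrite -(mulr0 (W a)); apply: cvgMr.
  by apply/gtr0_cvgV0 => //; near=> x; apply: (primitive_gt0 hw); near: x;
    apply: nbhs_pinfty_gt; exact: num_real.
apply: (cvg_comp _ _ c0); apply: continuous_asin.
by rewrite ltr01 andbT oppr_lt0 ltr01.
Unshelve. all: by end_near. Qed.

Lemma travel_small_at_infty (c r : R) : 0 < c -> pi / 2 / Num.sqrt c < r ->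
  h x @[x --> +oo] --> +oo -> W x @[x --> +oo] --> +oo ->
  (\forall s \near +oo, c * (2 * W s * w s) <= Z s) ->
  exists2 m, m0 < m & (T m <= r%:E)%E.
Proof.
move=> c0 cr hy Wy [M [_ MZ]].
pose a := Num.max M (m0 + 1).
have m0a : m0 < a by rewrite lt_max ltrDl ltr01 orbT.
have a0 := le_lt_trans m0_ge0 m0a.
have sc : 0 < Num.sqrt c by rewrite sqrtr_gt0.
(* One half of the slack pays for the head [(0, a)], the other for the arcsine term of the tail. *)
pose e := (r - pi / 2 / Num.sqrt c) / 2.
have e0 : 0 < e by rewrite divr_gt0// subr_gt0.
have esc : 0 < e * Num.sqrt c by rewrite mulr_gt0.
have Wa : 0 < W a / e by apply: divr_gt0 => //; exact: primitive_gt0.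
have near1 : \forall m \near +oo, `|asin (W a / W m)| < e * Num.sqrt c.
  move/cvgrPdist_lt : (asin_primitive_cvg0 a Wy) => /(_ _ esc).
  by apply: filterS => x; rewrite sub0r normrN.
(* Chosen so that the head bound [W a / sqrt (h m - h a)] is at most [e]. *)
have near2 : \forall m \near +oo, h a + (W a / e) ^+ 2 < h m.
  by move/cvgryPgt : hy; exact.
have near3 : \forall m \near +oo, a < m by apply: nbhs_pinfty_gt; exact: num_real.
have [m [as1 hm am]] : exists m, [/\ `|asin (W a / W m)| < e * Num.sqrt c,
    h a + (W a / e) ^+ 2 < h m & a < m].
  have [m [[H1 H2] H3]] := filter_ex (filterI (filterI near1 near2) near3).
  by exists m.
have m0m := lt_trans m0a am.
exists m => //; rewrite /T (travel_split hp m0m (a := a)) ?a0//.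
have ha : h a < h m by apply: (profile_lt hp m0m); rewrite a0.
have -> : r = e + (e + pi / 2 / Num.sqrt c) by rewrite /e; lra.
rewrite EFinD; apply: leeD.
- have hle s : 0 < s < a -> h s <= h a by move=> sI; exact/ltW/(profile_lt hp m0a).
  apply: le_trans (travel_head_bound hp a0 hle ha) _.
  have We : W a / e <= Num.sqrt (h m - h a).
    by rewrite -(gtr0_norm Wa) -sqrtr_sqr ler_wsqrtr//; lra.
  by rewrite lee_fin ler_pdivrMr ?sqrtr_gt0 ?subr_gt0// -ler_pdivrMl// mulrC.
- have H s : a < s < m -> c * (2 * W s * w s) <= Z s.
    by move=> /andP[as_ _]; apply: MZ; apply: le_lt_trans as_; rewrite le_max lexx.
  apply: le_trans (travel_upper hp c0 (ltW a0) am m0m H) _.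
  rewrite lee_fin mulrBl addrC lerD2r -mulNr ler_pdivrMr//.
  by move: as1; rewrite ltr_norml => /andP[]; rewrite -/W; lra.
Qed.

(** The head is discarded by nonnegativity. Divergence of [W] makes the arcsine of [W a / W m]
    negligible, so cutting at [a] costs nothing in the limit. *)
Lemma travel_large_at_infty (c r : R) : 0 < c -> r < pi / 2 / Num.sqrt c ->
  W x @[x --> +oo] --> +oo ->
  (\forall s \near +oo, Z s <= c * (2 * W s * w s)) ->
  exists2 m, m0 < m & (r%:E <= T m)%E.
Proof.
move=> c0 cr Wy [M [_ MZ]].
pose a := Num.max M (m0 + 1).
have m0a : m0 < a by rewrite lt_max ltrDl ltr01 orbT.
have a0 := le_lt_trans m0_ge0 m0a.
have sc : 0 < Num.sqrt c by rewrite sqrtr_gt0.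
pose e := pi / 2 / Num.sqrt c - r.
have e0 : 0 < e by rewrite subr_gt0.
have esc : 0 < e * Num.sqrt c by rewrite mulr_gt0.
have near1 : \forall m \near +oo, `|asin (W a / W m)| < e * Num.sqrt c.
  move/cvgrPdist_lt : (asin_primitive_cvg0 a Wy) => /(_ _ esc).
  by apply: filterS => x; rewrite sub0r normrN.
have near3 : \forall m \near +oo, a < m by apply: nbhs_pinfty_gt; exact: num_real.
have [m [as1 am]] : exists m, `|asin (W a / W m)| < e * Num.sqrt c /\ a < m.
  by have [m H] := filter_ex (filterI near1 near3); exists m.
have m0m := lt_trans m0a am.
exists m => //; rewrite /T (travel_split hp m0m (a := a)) ?a0//.
have H s : a < s < m -> Z s <= c * (2 * W s * w s).
  by move=> /andP[as_ _]; apply: MZ; apply: le_lt_trans as_; rewrite le_max lexx.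
apply: le_trans (le_trans (travel_lower hp c0 (ltW a0) am m0m H) _); last first.
  by rewrite leeDr// (travel_ge0 hp).
rewrite lee_fin mulrBl lerBrDr -lerBrDl ler_pdivrMr//.
by apply/ltW/(le_lt_trans (ler_norm _)); rewrite -/W.
Qed.

Lemma travel_small_at_0 (c : R) : m0 = 0 -> 0 < c ->
  (\forall s \near 0^'+, c * (2 * W s * w s) <= Z s) ->
  exists2 m, m0 < m & (T m <= (pi / 2 / Num.sqrt c)%:E)%E.
Proof.
move=> m00 c0 [d /= d0 dZ]; exists (d / 2); first by rewrite m00 divr_gt0.
have H s : 0 < s < d / 2 -> c * (2 * W s * w s) <= Z s.
  move=> /andP[s0 sd]; apply: dZ => //=.
  by rewrite sub0r normrN gtr0_norm//; lra.
have dm : m0 < d / 2 by rewrite m00 divr_gt0.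
have d2 : 0 < d / 2 by rewrite divr_gt0.
have := travel_upper hp c0 (lexx 0) d2 dm H.
by rewrite primitive0 mul0r asin0 subr0.
Qed.

Lemma travel_large_at_0 (c : R) : m0 = 0 -> 0 < c ->
  (\forall s \near 0^'+, Z s <= c * (2 * W s * w s)) ->
  exists2 m, m0 < m & ((pi / 2 / Num.sqrt c)%:E <= T m)%E.
Proof.
move=> m00 c0 [d /= d0 dZ]; exists (d / 2); first by rewrite m00 divr_gt0.
have H s : 0 < s < d / 2 -> Z s <= c * (2 * W s * w s).
  move=> /andP[s0 sd]; apply: dZ => //=.
  by rewrite sub0r normrN gtr0_norm//; lra.
have dm : m0 < d / 2 by rewrite m00 divr_gt0.
have d2 : 0 < d / 2 by rewrite divr_gt0.
have := travel_lower hp c0 (lexx 0) d2 dm H.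
by rewrite primitive0 mul0r asin0 subr0.
Qed.

End asymptotics.

(** * Consequences of the assumptions *)

Lemma hderivable_is_derive (R : realType) (f : R -> R) (x : R) :
  hderivable f x -> 0 < x -> is_derive x 1 f (hderiv f x).
Proof.
move=> fx x0; apply: is_derive_quotP; apply/cvgrPdist_le => e e0.
have /cvgrPdist_le /(_ _ e0) [d /= d0 dP] :
  hquot f x y @[y --> within `[0, +oo[ x^'] --> hderiv f x by exact: fx.
(* The bound by [x] keeps [k + x] in [[0, +oo)], where the one-sided quotient is controlled. *)
exists (Num.min d x) => /=; first by rewrite lt_min d0.
move=> k /=; rewrite sub0r normrN lt_min => /andP[kd kx] k0.
have := dP (k + x); rewrite /= /hquot addrK [_ *: _]mulrC; apply.
- by rewrite opprD addrCA subrr addr0 normrN.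
- by apply: contra_neq k0 => kx0; lra.
- rewrite in_itv/= andbT; have := ler_norm (- k); rewrite normrN; lra.
Qed.

Lemma hC1_within_continuous (R : realType) (f : R -> R) : hC1 f ->
  {within `[0, +oo[, continuous f}.
Proof.
move=> [df _]; apply/continuous_within_itvcyP; split.
  move=> x; rewrite in_itv/= andbT => x0.
  exact: is_derive_continuous (hderivable_is_derive (df x (ltW x0)) x0).
have q0 : hquot f 0 y @[y --> (0 : R)^'+] --> hderiv f 0.
  have q : hquot f 0 y @[y --> within `[0, +oo[ (0 : R)^'] --> hderiv f 0 by exact: df.
  apply: cvg_trans q; apply: cvg_app => A [d /= d0 dA]; exists d => // y /= yd y0.
  by apply: dA => //; [rewrite gt_eqF|rewrite in_itv/= andbT ltW].
have id0 : (fun y : R => y) y @[y --> (0 : R)^'+] --> (0 : R).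
  by apply: (@cvg_at_right_filter _ _ (fun y : R => y)); exact: cvg_id.
have c : f 0 + hquot f 0 y * y @[y --> (0 : R)^'+] --> f 0 + hderiv f 0 * 0.
  by apply: cvgD; [exact: cvg_cst|exact: cvgM q0 id0].
rewrite mulr0 addr0 in c.
apply: cvg_trans c; apply: near_eq_cvg; near=> y.
have y0 : 0 < y by near: y; exact: nbhs_right_gt.
by rewrite /hquot subr0 divfK ?gt_eqF// addrC subrK.
Unshelve. all: by end_near. Qed.

(* [F], [G], [K] are meaningless at negative arguments, hence the clamping at [0]. *)
Lemma continuous_clamp (R : realType) (f : R -> R) :
  {within `[0, +oo[, continuous f} -> continuous (fun x : R => f (Num.max 0 x)).
Proof.
move=> cf x.
have cm : Num.max 0 y @[y --> x] --> Num.max 0 x.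
  by apply: (@continuous_max R R (cst 0) id); [exact: cvg_cst|exact: cvg_id].
apply: (cvg_within_comp cf) cm.
- by rewrite /= in_itv/= andbT le_max lexx.
- by apply: filterE => y; rewrite /= in_itv/= andbT le_max lexx.
Qed.

Section A0A1.
Variables (R : realType) (F G : R -> R).
Hypothesis hA0 : assumptionA0 F G.
Hypothesis hA1 : assumptionA1 F G.

Let f := hderiv F.
Let g := hderiv G.
Let h s := F s / G s.
Let Z := Zfun F G.

Lemma A0_continuousF : {within `[0, +oo[, continuous F}.
Proof. by case: hA0 => -[hF _] _; exact: hC1_within_continuous. Qed.

Lemma A0_continuousG : {within `[0, +oo[, continuous G}.
Proof. by case: hA0 => -[_ hG] _; exact: hC1_within_continuous. Qed.

Lemma A0_deriveF (s : R) : 0 < s -> is_derive s 1 F (f s).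
Proof.
case: hA0 => -[[dF _] _] _ s0.
exact: hderivable_is_derive (dF s (ltW s0)) s0.
Qed.

Lemma A0_deriveG (s : R) : 0 < s -> is_derive s 1 G (g s).
Proof.
case: hA0 => -[_ [dG _]] _ s0.
exact: hderivable_is_derive (dG s (ltW s0)) s0.
Qed.

Lemma A0_G_gt0 s : 0 < s -> 0 < G s.
Proof.
case: hA0 => _ [[_ G0 _ _] [gpos _]] s0.
have [||c] := @MVT _ G g 0 s s0.
- by move=> x; rewrite in_itv/= => /andP[x0 _]; exact: A0_deriveG.
- apply: continuous_subspaceW A0_continuousG.
  exact: subset_itvl.
- rewrite in_itv/= => /andP[c0 _]; rewrite G0 !subr0 => ->.
  by rewrite mulr_gt0// gpos.
Qed.

Lemma is_derive_ratio (s : R) : 0 < s ->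
  is_derive s 1 h (G s ^- 2 * (f s * G s - F s * g s)).
Proof.
move=> s0; have Gs := A0_G_gt0 s0.
have dF := A0_deriveF s0; have dG := A0_deriveG s0.
have Gn0 : G s != 0 by rewrite gt_eqF.
have d1 := is_deriveV Gn0 dG.
have d2 := is_deriveM dF d1.
have -> : G s ^- 2 * (f s * G s - F s * g s) =
    F s *: (- G s ^- 2 *: g s) + (G s)^-1 *: f s.
  by rewrite /GRing.scale/=; field.
exact: d2.
Qed.

Lemma ZfunE s : 0 < s -> Z s = G s ^- 2 * (f s * G s - F s * g s).
Proof. by move=> s0; rewrite /Z /Zfun derive1E; have [_ ->] := is_derive_ratio s0. Qed.

Lemma is_derive_ratio_Zfun (s : R) : 0 < s -> is_derive s 1 h (Z s).
Proof. by move=> s0; rewrite ZfunE//; exact: is_derive_ratio. Qed.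

Lemma Zfun_continuous (s : R) : 0 < s -> {for s, continuous Z}.
Proof.
move=> s0; case: hA0 => -[[_ cf] [_ cg]] _.
have /continuous_within_itvcyP[cf' _] := cf.
have /continuous_within_itvcyP[cg' _] := cg.
have sI : s \in `]0, +oo[ by rewrite in_itv/= s0.
have cF := is_derive_continuous (A0_deriveF s0).
have cG := is_derive_continuous (A0_deriveG s0).
have c1 : {for s, continuous (fun s => f s * G s - F s * g s)}.
  by apply: cvgB; [exact: cvgM (cf' s sI) cG|exact: cvgM cF (cg' s sI)].
have c2 : {for s, continuous (fun s => G s ^- 2)}.
  apply: cvgV; first by rewrite expf_neq0// gt_eqF// A0_G_gt0.
  exact: (continuous_comp cG (@exprn_continuous R 2 (G s))).
have c3 : G x ^- 2 * (f x * G x - F x * g x) @[x --> s] --> Z s.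
  by rewrite ZfunE//; exact: cvgM c2 c1.
apply: cvg_trans c3.
apply: near_eq_cvg; near=> x; rewrite ZfunE//.
by near: x; exact: lt_nbhsr.
Unshelve. all: by end_near. Qed.

Lemma ratio_gt0 s : 0 < s -> (0 < h s) = (0 < F s).
Proof. by move=> s0; rewrite pmulr_lgt0// invr_gt0 A0_G_gt0. Qed.

(* Where [F > 0] the ratio is increasing, so it cannot come back to [0]. *)
Lemma F_gt0_propagates s t : 0 < s -> s <= t -> 0 < F s -> 0 < F t.
Proof.
move=> s0 st Fs; rewrite ltNge; apply/negP => Ft.
have ch : {within `[s, t], continuous h}.
  apply: continuous_in_subspaceT => x; rewrite inE/= in_itv/= => /andP[sx _].
  exact: is_derive_continuous (is_derive_ratio (lt_le_trans s0 sx)).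
(* If [F t <= 0], the maximum point [c] of [h] lies before [t] and satisfies [h c > 0]. Then (A1)
   gives [Z > 0] near [c], so [h] exceeds its maximum just to the right. *)
have [c cI hmax] := EVT_max st ch.
have /andP[sc ct] : s <= c <= t by move: cI; rewrite in_itv.
have c0 : 0 < c by exact: lt_le_trans sc.
have hs : 0 < h s by rewrite ratio_gt0.
have hc : 0 < h c.
  by apply: lt_le_trans hs (hmax s _); rewrite in_itv/= lexx.
have Fc : 0 < F c by rewrite -ratio_gt0.
have {}ct : c < t.
  rewrite lt_neqAle ct andbT; apply/eqP => ct'.
  by move: Fc; rewrite ct' ltNge Ft.
have Zc : 0 < Z c by exact: hA1.
have [d /= d0 dZ] : \forall x \near c, 0 < Z x.
  have := Zfun_continuous c0; move/cvgrPdist_lt => /(_ _ Zc).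
  by apply: filterS => x; rewrite ltr_norml => /andP[]; lra.
pose y := c + Num.min d (t - c) / 2.
have e0 : 0 < Num.min d (t - c) by rewrite lt_min d0 subr_gt0.
have ed : Num.min d (t - c) <= d by rewrite ge_min lexx.
have et : Num.min d (t - c) <= t - c by rewrite ge_min lexx orbT.
have cy : c < y by rewrite /y; lra.
have yt : y <= t by rewrite /y; lra.
have [|x /andP[cx xy] E] := @profile_MVT _ h Z c y cy.
  by move=> x /andP[cx _]; apply: is_derive_ratio_Zfun; exact: lt_le_trans cx.
have Zx : 0 < Z x.
  by apply: dZ; rewrite /= ltr0_norm; move: xy; rewrite /y; lra.
have hyc : h y <= h c by apply: hmax; rewrite in_itv/= yt andbT; lra.
have : 0 < h y - h c by rewrite E mulr_gt0// subr_gt0.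
by rewrite subr_gt0 ltNge hyc.
Qed.

(** The set is bounded because [F / G] tends to [+oo], and continuity puts its supremum in it. For
    [s] beyond the maximum, [F] is positive somewhere in [[0, s]], and positivity propagates to
    [s]. *)
Lemma m0_spec : [/\ 0 <= m0 F, forall s, 0 <= s <= m0 F -> F s <= 0 &
  forall s, m0 F < s -> 0 < F s].
Proof.
have [_ [[F0 _ _ _] [_ [_ hy]]]] := hA0.
pose A := [set t : R | 0 <= t /\ forall s, 0 <= s <= t -> F s <= 0].
have A0 : A 0.
  split=> // s /andP[s0 s1]; have -> : s = 0 by apply/eqP; rewrite eq_le s1.
  by rewrite F0.
have [M MA] : exists M, ubound A M.
  have [M [_ Mh]] : \forall x \near +oo, 0 < h x by move/cvgryPgt : hy; exact.
  pose b := Num.max M 0 + 1.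
  have b0 : 0 < b by rewrite ltr_wpDl// le_max lexx orbT.
  have Mb : M < b by rewrite (@le_lt_trans _ _ (Num.max M 0)) ?le_max ?lexx// ltrDl.
  exists b => t [t0 tF]; rewrite leNgt; apply/negP => bt.
  have := Mh b Mb; rewrite ratio_gt0// ltNge tF//.
  by rewrite !ltW.
have Asup : has_sup A by split; [exists 0|exists M].
have sup0 : 0 <= sup A by exact: sup_upper_bound Asup _ A0.
have belowF s : 0 <= s -> s < sup A -> F s <= 0.
  move=> s0 /(sup_gt (ex_intro _ 0 A0)) [t [t0 tF] st].
  by apply: tF; rewrite s0 ltW.
have supF : F (sup A) <= 0.
  move: sup0; rewrite le_eqVlt => /predU1P[<-|sup0]; first by rewrite F0.
  rewrite leNgt; apply/negP => Fpos.
  have cF := is_derive_continuous (A0_deriveF sup0).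
  move/cvgrPdist_lt : cF => /(_ _ Fpos)[d /= d0 dF].
  pose y := sup A - Num.min d (sup A) / 2.
  have e0 : 0 < Num.min d (sup A) by rewrite lt_min d0.
  have e1 : Num.min d (sup A) <= d by rewrite ge_min lexx.
  have e2 : Num.min d (sup A) <= sup A by rewrite ge_min lexx orbT.
  have y0 : 0 <= y by rewrite /y; lra.
  have ys : y < sup A by rewrite /y; lra.
  have Fy := belowF y y0 ys.
  have /= := dF y; rewrite gtr0_norm ?subr_gt0// => /(_ _).
  have -> : sup A - y < d by rewrite /y; lra.
  by move=> /(_ isT); rewrite ltr_norml => /andP[_]; lra.
have AsupA : A (sup A).
  split=> // s /andP[s0]; rewrite le_eqVlt => /predU1P[->//|]; exact: belowF.
have Mex : exists m, [set m | A m /\ ubound A m] m.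
  by exists (sup A); split=> //; exact: sup_upper_bound.
have [[m0_0 m0F] m0ub] : [set m | A m /\ ubound A m] (m0 F) := xgetPex 0 Mex.
split=> // s ms.
have s0 : 0 < s by exact: le_lt_trans ms.
have : ~ A s by move=> /m0ub; rewrite leNgt ms.
move=> nA; have [t [/andP[t0 ts] Ft]] : exists t, 0 <= t <= s /\ 0 < F t.
  apply: contrapT => nex; apply: nA; split; first exact: ltW.
  by move=> t tI; rewrite leNgt; apply/negP => Ft; apply: nex; exists t.
have {}t0 : 0 < t.
  move: t0; rewrite le_eqVlt => /predU1P[t00|//].
  by move: Ft; rewrite -t00 F0 ltxx.
exact: F_gt0_propagates Ft.
Qed.

Lemma A0_mass_profile (w : R -> R) : weight_profile w -> mass_profile (m0 F) h Z w.
Proof.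
move=> hw; have [m00 Fle Fgt] := m0_spec; split=> //.
- by move=> s s0; exact: is_derive_ratio_Zfun.
- by move=> s s0; exact: Zfun_continuous.
- move=> s ms; apply: hA1; [exact: le_lt_trans ms|exact: Fgt].
- move=> s /andP[s0 sm]; rewrite leNgt ratio_gt0// -leNgt Fle// sm ltW//.
- by move=> s ms; rewrite ratio_gt0 ?Fgt//; exact: le_lt_trans ms.
Qed.

Lemma A2_weight_profile (K : R -> R) : assumptionA2 G K -> weight_profile (weight G K).
Proof.
move=> [/continuous_within_itvcyP[cK _] [_ [Kpos [[d d0 di] _]]]].
have w0 s : 0 < s -> 0 < weight G K s.
  by move=> s0; rewrite divr_gt0 ?Kpos// sqrtr_gt0 A0_G_gt0.
have cw (s : R) : 0 < s -> {for s, continuous (weight G K)}.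
  move=> s0; apply: continuous_div_sqrt; last exact: A0_G_gt0.
  - by apply: cK; rewrite in_itv/= s0.
  - exact: is_derive_continuous (A0_deriveG s0).
have mw (a b : R) : 0 <= a -> measurable_fun `]a, b[ (weight G K).
  move=> a0; apply: in_continuous_measurable_oo => s; rewrite in_itv/= => /andP[as_ _].
  by apply: cw; exact: le_lt_trans as_.
split=> // b.
have [bd|db] := leP b d.
  by apply: integrableS di => //; apply: subset_itvl; rewrite bnd_simp.
pose a := d / 2.
have a0 : 0 < a by rewrite /a; lra.
have ad : a < d by rewrite /a; lra.
have ab : a < b by lra.
have i1 : (\int[mu]_(s in `]0%R, a[) (weight G K s)%:E < +oo)%E.
  have : mu.-integrable `]0, a[ (EFin \o weight G K).
    by apply: integrableS di => //; apply: subset_itvl; rewrite bnd_simp ltW.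
  by move=> /integrable_fin_num => /(_ (measurable_itv _)); rewrite ltey_eq => ->.
have i2 : (\int[mu]_(s in `]a, b[) (weight G K s)%:E < +oo)%E.
  have : mu.-integrable `]a, b[ (EFin \o weight G K).
    have cab : {within `[a, b], continuous (weight G K)}.
      apply: continuous_in_subspaceT => s; rewrite inE/= in_itv/= => /andP[as_ _].
      by apply: cw; exact: lt_le_trans as_.
    have ci := continuous_compact_integrable (@segment_compact R a b) cab.
    by apply: (integrableS _ _ _ ci) => //; apply: subset_itv; rewrite bnd_simp.
  by move=> /integrable_fin_num => /(_ (measurable_itv _)); rewrite ltey_eq => ->.
apply/integrableP; split; first by apply/measurable_EFinP; exact: mw.
apply: (@le_lt_trans _ _ (\int[mu]_(s in `]0%R, b[) (weight G K s)%:E)%E).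
  rewrite le_eqVlt; apply/orP; left; apply/eqP; apply: eq_integral => s.
  rewrite inE/= in_itv/= => /andP[s0 _].
  by rewrite gtr0_norm// w0.
rewrite (integral_oo_split (c := a)) ?a0 ?ab//.
- exact: lte_add_pinfty.
- exact: mw.
- by move=> s /andP[s0 _]; exact/ltW/w0.
Qed.

End A0A1.

(** * The critical amplitude *)

Lemma limf_esup_lt (R : realType) (T : choiceType) (X : filteredType T)
    (f : X -> \bar R) (F : set_system X) (c : \bar R) {FF : Filter F} :
  (limf_esup f F < c)%E -> \forall x \near F, (f x < c)%E.
Proof.
move=> /ereal_inf_lt[_ [V FV <-] Vc]; apply: filterS FV => x Vx.
by apply: le_lt_trans Vc; apply: ereal_sup_ubound; exists x.
Qed.

Lemma lt_limf_einf (R : realType) (T : choiceType) (X : filteredType T)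
    (f : X -> \bar R) (F : set_system X) (c : \bar R) {FF : Filter F} :
  (c < limf_einf f F)%E -> \forall x \near F, (c < f x)%E.
Proof.
rewrite /limf_einf lteNr => /limf_esup_lt; apply: filterS => x.
by rewrite lteN2.
Qed.

Section critical_value.
Variables (R : realType) (rho : R).
Hypothesis rho0 : 0 < rho.

(** The solution of [pi / sqrt (2 c0) = rho]: comparing [rho] with [pi_sqrt2 L] amounts to comparing
    [L] with [c0], in the reverse order. *)
Let c0 : R := pi ^+ 2 / (2 * rho ^+ 2).

Lemma critical_value_gt0 : 0 < c0.
Proof. by rewrite divr_gt0// ?exprn_gt0 ?pi_gt0// mulr_gt0// exprn_gt0. Qed.

Lemma sqrt_critical_value : Num.sqrt (2 * c0) = pi / rho.
Proof.
have -> : 2 * c0 = (pi / rho) ^+ 2 by rewrite /c0; field; rewrite gt_eqF.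
by rewrite sqrtr_sqr gtr0_norm// divr_gt0// pi_gt0.
Qed.

Lemma pi_half_sqrt_critical_value : pi / 2 / Num.sqrt c0 = rho / Num.sqrt 2.
Proof.
have c00 := critical_value_gt0.
have s2 : 0 < Num.sqrt 2 :> R by rewrite sqrtr_gt0.
have sc : 0 < Num.sqrt c0 by rewrite sqrtr_gt0.
have E : Num.sqrt 2 * Num.sqrt c0 = pi / rho.
  by rewrite -sqrtrM// sqrt_critical_value.
have E2 : Num.sqrt 2 ^+ 2 = 2 :> R by rewrite sqr_sqrtr.
have p0 : 0 < pi :> R := pi_gt0 R.
have -> : Num.sqrt c0 = pi / rho / Num.sqrt 2.
  by rewrite -E mulrAC divff ?mul1r// gt_eqF.
(* Writing [2] as the square of [s] turns the identity into one between rational functions, within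
   reach of [field]. *)
have H (p s : R) : 0 < p -> 0 < s -> s ^+ 2 = 2 -> p / 2 / (p / rho / s) = rho / s.
  by move=> p_gt0 s0 <-; field; rewrite !gt_eqF.
exact: H.
Qed.

Lemma pi_sqrt2E (l : R) : 0 < l -> pi_sqrt2 l%:E = (pi / Num.sqrt (2 * l))%:E.
Proof.
move=> l0; rewrite /pi_sqrt2 -EFinM /= inver gt_eqF// sqrtr_gt0.
by rewrite mulr_gt0.
Qed.

(** [sqrte] vanishes on nonpositive arguments. The comparisons below thus hold without information
    on the sign of [L]. *)
Lemma pi_sqrt2_npos (L : \bar R) : (L <= 0)%E -> pi_sqrt2 L = +oo%E.
Proof.
move=> L0; rewrite /pi_sqrt2.
have -> : sqrte (2%:E * L) = 0%E.
  case: L L0 => [l| |]//=.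
  - rewrite lee_fin => l0; rewrite ler0_sqrtr// mulr_ge0_le0//.
  - by rewrite gt0_muleNy// lte_fin.
by rewrite inve0 gt0_muley// lte_fin pi_gt0.
Qed.

Lemma lt_pi_sqrt2 (L : \bar R) : (rho%:E < pi_sqrt2 L)%E -> (L < c0%:E)%E.
Proof.
have c00 := critical_value_gt0.
have [L0 _|L0] := leP L 0%E; first by apply: le_lt_trans L0 _; rewrite lte_fin.
case: L L0 => [l| |]//.
- rewrite lte_fin => l0; rewrite pi_sqrt2E// !lte_fin => H.
  have sl : 0 < Num.sqrt (2 * l) by rewrite sqrtr_gt0 mulr_gt0.
  have : Num.sqrt (2 * l) < Num.sqrt (2 * c0).
    by rewrite sqrt_critical_value ltr_pdivlMr// mulrC -ltr_pdivlMr.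
  by rewrite ltr_sqrt; [rewrite ltr_pM2l|exact: mulr_gt0].
- move=> _; rewrite /pi_sqrt2.
  have -> : (2%:E * +oo = +oo :> \bar R)%E by rewrite gt0_muley// lte_fin.
  by rewrite /sqrte invey mule0 lte_fin ltNge ltW.
Qed.

Lemma pi_sqrt2_lt (L : \bar R) : (pi_sqrt2 L < rho%:E)%E -> (c0%:E < L)%E.
Proof.
have c00 := critical_value_gt0.
have [L0|L0] := leP L 0%E; first by rewrite pi_sqrt2_npos.
case: L L0 => [l| |]//; last by move=> _ _; exact: ltry.
rewrite lte_fin => l0; rewrite pi_sqrt2E// !lte_fin => H.
have sl : 0 < Num.sqrt (2 * l) by rewrite sqrtr_gt0 mulr_gt0.
have : Num.sqrt (2 * c0) < Num.sqrt (2 * l).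
  by rewrite sqrt_critical_value ltr_pdivrMr// mulrC -ltr_pdivrMr.
by rewrite ltr_sqrt; [rewrite ltr_pM2l|exact: mulr_gt0].
Qed.

(* The slack between [c] and the critical value [c0] absorbs the part of the
   integral where the bound on [Z] is not yet available. *)
Lemma critical_slack_lt (L : \bar R) : (L < c0%:E)%E ->
  exists c, [/\ 0 < c, (L < c%:E)%E & rho / Num.sqrt 2 < pi / 2 / Num.sqrt c].
Proof.
have c00 := critical_value_gt0; move=> Lc.
have [c [c_gt0 Lc' cc]] : exists c, [/\ 0 < c, (L < c%:E)%E & c < c0].
  case: L Lc => [l| |]//.
  (* The maximum with [0] keeps the midpoint positive when [l] is negative. *)
  - rewrite lte_fin => lc; exists ((Num.max l 0 + c0) / 2).
    have m0 : 0 <= Num.max l 0 by rewrite le_max lexx orbT.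
    have ml : l <= Num.max l 0 by rewrite le_max lexx.
    have mc : Num.max l 0 < c0 by rewrite gt_max lc.
    by rewrite lte_fin; split; lra.
  - by move=> _; exists (c0 / 2); rewrite ltNyr; split=> //; lra.
exists c; split=> //; rewrite -pi_half_sqrt_critical_value.
rewrite ltr_pM2l ?divr_gt0 ?pi_gt0// ltf_pV2 ?posrE ?sqrtr_gt0//.
by rewrite ltr_sqrt.
Qed.

Lemma critical_slack_gt (L : \bar R) : (c0%:E < L)%E ->
  exists c, [/\ 0 < c, (c%:E < L)%E & pi / 2 / Num.sqrt c < rho / Num.sqrt 2].
Proof.
have c00 := critical_value_gt0; move=> Lc.
have [c [Lc' cc]] : exists c, (c%:E < L)%E /\ c0 < c.
  case: L Lc => [l| |]//.
  - by rewrite lte_fin => lc; exists ((l + c0) / 2); rewrite lte_fin; split; lra.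
  - by move=> _; exists (c0 + 1); rewrite ltry; split=> //; lra.
have c_gt0 := lt_trans c00 cc.
exists c; split=> //; rewrite -pi_half_sqrt_critical_value.
rewrite ltr_pM2l ?divr_gt0 ?pi_gt0// ltf_pV2 ?posrE ?sqrtr_gt0//.
by rewrite ltr_sqrt.
Qed.

End critical_value.

(** * Matching the prescribed mass *)

Section final.
Variables (R : realType) (F G K : R -> R).
Hypothesis hA0 : assumptionA0 F G.
Hypothesis hA1 : assumptionA1 F G.
Hypothesis hA2 : assumptionA2 G K.

Let h s := F s / G s.
Let Z := Zfun F G.
Let w := weight G K.
Let W := primitive w.
Let hw : weight_profile w := A2_weight_profile hA0 hA2.
Let hp : mass_profile (m0 F) h Z w := A0_mass_profile hA0 hA1 hw.

Lemma derive1_Phi s : 0 < s -> derive1 (Phi G K) s = 2 * W s * w s.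
Proof.
by move=> s0; rewrite derive1E; have [_ ->] := is_derive_primitive_sqr hp s0.
Qed.

Lemma derive1_Phi_gt0 s : 0 < s -> 0 < 2 * W s * w s.
Proof.
move=> s0; apply: mulr_gt0; last exact: weight_gt0 hw _ s0.
by apply: mulr_gt0 => //; exact: primitive_gt0 hw s0.
Qed.

Lemma ratio_lt (s c : R) : 0 < s -> (Defs.ratio F G K s < c%:E)%E ->
  Z s <= c * (2 * W s * w s).
Proof.
move=> s0; rewrite /Defs.ratio derive1_Phi// lte_fin ltr_pdivrMr ?derive1_Phi_gt0//.
exact: ltW.
Qed.

Lemma ratio_gt (s c : R) : 0 < s -> (c%:E < Defs.ratio F G K s)%E ->
  c * (2 * W s * w s) <= Z s.
Proof.
move=> s0; rewrite /Defs.ratio derive1_Phi// lte_fin ltr_pdivlMr ?derive1_Phi_gt0//.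
exact: ltW.
Qed.

(** On [(0, m0]] one has [|F| = G * (- h)], so the factor [sqrt G] passes into the weight; where [F]
    vanishes both integrands are [+oo]. *)
Lemma IF_travel : IF F K = ((Num.sqrt 2)%:E *
  \int[mu]_(s in `]0%R, m0 F]) ((w s)%:E / (Num.sqrt (- h s))%:E))%E.
Proof.
congr (_ * _)%E; apply: eq_integral => s; rewrite inE/= in_itv/= => sI.
have /andP[s0 sm] := sI; have Gs := A0_G_gt0 hA0 s0.
have [_ [_ [Kpos _]]] := hA2; have Ks := Kpos s s0.
have ws := weight_gt0 hw s0.
have [_ Fle _] := m0_spec hA0 hA1.
have Fs : F s <= 0 by apply: Fle; rewrite ltW.
move: Fs; rewrite le_eqVlt => /predU1P[Fs0|Fs].
  by rewrite /h Fs0 mul0r oppr0 normr0 sqrtr0 inve0 !gt0_muley ?lte_fin.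
have hs : 0 < - h s by rewrite oppr_gt0 /h pmulr_llt0 ?invr_gt0.
have Fn : 0 < - F s by rewrite oppr_gt0.
rewrite !inver !gt_eqF ?sqrtr_gt0 ?normr_gt0 ?lt_eqF// -!EFinM; congr EFin.
rewrite /w /weight ltr0_norm//.
have -> : - F s = G s * - h s by rewrite /h; field; rewrite gt_eqF.
by rewrite sqrtrM ?(ltW Gs)// invfM mulrA.
Qed.

Lemma exists_critical_amplitude (rho : R) : 0 < rho -> admissible_mass F G K rho ->
  exists2 m, m0 F < m & travel h w 0 m (h m) = (rho / Num.sqrt 2)%:E.
Proof.
move=> rho0; set r := rho / Num.sqrt 2.
have s2 : 0 < Num.sqrt 2 :> R by rewrite sqrtr_gt0.
have hy : h x @[x --> +oo] --> +oo by case: hA0 => _ [_ [_ []]].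
have Wy : W x @[x --> +oo] --> +oo.
  by apply: primitive_cvgy => //; case: hA2 => _ [_ [_ []]].
have pos_y : \forall s \near (+oo : set_system R), 0 < s.
  by apply: nbhs_pinfty_gt; exact: num_real.
have pos_0 : \forall s \near 0^'+, (0 : R) < s by exact: nbhs_right_gt.
have c00 := critical_value_gt0 rho0.
have small_y : (pi_sqrt2 (linfy F G K) < rho%:E)%E ->
    exists2 m, m0 F < m & (travel h w 0 m (h m) <= r%:E)%E.
  move=> /(pi_sqrt2_lt rho0) /(critical_slack_gt rho0) [c [c0 /lt_limf_einf cL cr]].
  apply: (travel_small_at_infty hp c0 cr hy Wy).
  by apply: filterS2 pos_y cL => s; exact: ratio_gt.
have large_y : (rho%:E < pi_sqrt2 (Lsupy F G K))%E ->
    exists2 m, m0 F < m & (r%:E <= travel h w 0 m (h m))%E.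
  move=> /(lt_pi_sqrt2 rho0) /(critical_slack_lt rho0) [c [c0 /limf_esup_lt cL cr]].
  apply: (travel_large_at_infty hp c0 cr Wy).
  by apply: filterS2 pos_y cL => s; exact: ratio_lt.
have rE (I : \bar R) :
  ((rho%:E < (Num.sqrt 2)%:E * I)%E = (r%:E < I)%E) *
  (((Num.sqrt 2)%:E * I < rho%:E)%E = (I < r%:E)%E).
  by rewrite -(lte_pdivrMl _ _ s2) -(lte_pdivlMl _ _ s2) -EFinM mulrC.
case=> [[m00 _ /andP[H1 H2]]|[m00 _ /andP[H1 H2]]|[m00 _ /andP[H1 H2]]|
  [m00 Fm _ /andP[H1 H2]]].
- have [a m0a Ta] := small_y H1.
  (* Near [0] the critical value itself serves as the constant, since the estimate there has no
     error term. *)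
  have [b m0b Tb] : exists2 m, m0 F < m & (r%:E <= travel h w 0 m (h m))%E.
    rewrite /r -(pi_half_sqrt_critical_value rho0).
    apply: (travel_large_at_0 hp m00 c00).
    have cL := @limf_esup_lt _ _ _ _ _ _ (at_right_proper_filter (0 : R))
      (lt_pi_sqrt2 rho0 H2).
    by apply: filterS2 pos_0 cL => s; exact: ratio_lt.
  exact: (travel_IVT hp m0a m0b Ta Tb).
- have [b m0b Tb] := large_y H2.
  have [a m0a Ta] : exists2 m, m0 F < m & (travel h w 0 m (h m) <= r%:E)%E.
    rewrite /r -(pi_half_sqrt_critical_value rho0).
    apply: (travel_small_at_0 hp m00 c00).
    have cL := @lt_limf_einf _ _ _ _ _ _ (at_right_proper_filter (0 : R))
      (pi_sqrt2_lt rho0 H1).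
    by apply: filterS2 pos_0 cL => s; exact: ratio_gt.
  exact: (travel_IVT hp m0a m0b Ta Tb).
- have [a m0a Ta] := small_y H1.
  move: H2; rewrite IF_travel rE.
  move=> /(travel_above_threshold hp m00) [b m0b /ltW Tb].
  exact: (travel_IVT hp m0a m0b Ta Tb).
- have [b m0b Tb] := large_y H2.
  (* Since [F (m0 F) = 0], this value of [Z] is [F'(m0) / G(m0)], nonzero by hypothesis. It is
     nonnegative as a limit from the right of positive values. *)
  have Zm : 0 < Z (m0 F).
    rewrite lt_neqAle eq_sym; apply/andP; split.
      have Fm0 : F (m0 F) = 0.
        have /eqP := profile_threshold hp m00; rewrite mulf_eq0 invr_eq0.
        by rewrite (gt_eqF (A0_G_gt0 hA0 m00)) orbF => /eqP.
      rewrite /Z (ZfunE hA0)// Fm0 mul0r subr0 mulf_neq0//.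
        by rewrite invr_eq0 expf_neq0// gt_eqF// (A0_G_gt0 hA0).
      by rewrite mulf_neq0//; [exact/eqP|rewrite gt_eqF// (A0_G_gt0 hA0)].
    have cZ : Z x @[x --> (m0 F)^'+] --> Z (m0 F).
      by apply: cvg_at_right_filter; exact: (profile_continuous hp).
    rewrite -(cvg_lim _ cZ)//; apply: limr_ge; first by apply/cvg_ex; exists (Z (m0 F)).
    near=> x; apply/ltW/(profile_derive_gt0 hp).
    by near: x; exact: nbhs_right_gt.
  move: H1; rewrite IF_travel rE.
  move=> /(travel_below_threshold hp m00 Zm) [a m0a /ltW Ta].
  exact: (travel_IVT hp m0a m0b Ta Tb).
Unshelve. all: by end_near. Qed.

End final.

Theorem theorem1p1 (R : realType) (F G K : R -> R) (rho : R)
  (hA0 : assumptionA0 F G) (hA1 : assumptionA1 F G) (hA2 : assumptionA2 G K)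
  (hrho : 0 < rho) (hcase : admissible_mass F G K rho) :
  exists (lambda : R) (u : R -> R),
    (0 < lambda /\ C2 u) /\
    (forall x, 0 <= u x) /\
    (forall x, - derive1n 2 u x + lambda * hderiv G (u x) = hderiv F (u x)) /\
    (\int[lebesgue_measure]_x (K (u x))%:E = rho%:E)%E /\
    derive1 u \in Lfun lebesgue_measure 2%:E /\
    (forall x, u (- x) = u x) /\
    u x @[x --> +oo] --> 0 /\ u x @[x --> -oo] --> 0.
Proof.
have hw := A2_weight_profile hA0 hA2.
have hp := A0_mass_profile hA0 hA1 hw.
have [m mm Tm] := exists_critical_amplitude hA0 hA1 hA2 hrho hcase.
have m_gt0 : 0 < m := le_lt_trans (profile_ge0 hp) mm.
pose lambda := F m / G m.
have lambda0 : 0 < lambda := profile_gt0 hp mm.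
have hlt s : 0 < s < m -> F s / G s < lambda := profile_lt hp mm.
have [[[_ cf] [_ cg]] [[F0 G0 f0 g0] _]] := hA0.
have [cK [K0 [Kpos _]]] := hA2.
have cFc := continuous_clamp (A0_continuousF hA0).
have cGc := continuous_clamp (A0_continuousG hA0).
have cfc := continuous_clamp cf.
have cgc := continuous_clamp cg.
(* Half of [u'^2] in the first integral. The factorization [P = G * (lambda - F / G)] makes it
   positive on [(0, m)] and zero at [m]. *)
pose P (x : R) := lambda * G (Num.max 0 x) - F (Num.max 0 x).
pose p (x : R) := lambda * hderiv G (Num.max 0 x) - hderiv F (Num.max 0 x).
have maxE (s : R) : 0 <= s -> Num.max 0 s = s by move=> s0; exact/max_idPr.
have cP : continuous P.
  by move=> x; apply: cvgB; [apply: cvgMr; exact: cGc|exact: cFc].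
have cp : continuous p.
  by move=> x; apply: cvgB; [apply: cvgMr; exact: cgc|exact: cfc].
have PE s : 0 < s -> P s = G s * (lambda - F s / G s).
  move=> s0; rewrite /P maxE ?ltW//; field.
  by rewrite gt_eqF// (A0_G_gt0 hA0).
have Ppos s : 0 < s < m -> 0 < P s.
  move=> sI; have /andP[s0 _] := sI.
  by rewrite PE// mulr_gt0 ?(A0_G_gt0 hA0)// subr_gt0 hlt.
have dP (s : R) : 0 < s < m -> is_derive s 1 P (p s).
  move=> /andP[s0 _]; rewrite /p maxE ?ltW//.
  have dF := A0_deriveF hA0 s0; have dG := A0_deriveG hA0 s0.
  have d1 : is_derive s 1 (lambda \*: G) (lambda *: hderiv G s) by exact: is_deriveZ.
  have d2 : is_derive s 1 (lambda \*: G - F) (lambda *: hderiv G s - hderiv F s).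
    exact: is_deriveB.
  apply: near_eq_is_derive d2; near=> x; rewrite /P maxE//.
  by apply: ltW; near: x; exact: lt_nbhsr.
pose k (x : R) := K (Num.max 0 x).
pose q s := weight G K s / Num.sqrt (F m / G m - F s / G s).
have kqE s : 0 < s < m -> k s / Num.sqrt (2 * P s) = (Num.sqrt 2)^-1 * q s.
  move=> sI; have /andP[s0 sm] := sI; have Gs := A0_G_gt0 hA0 s0.
  have D : 0 <= lambda - F s / G s by rewrite subr_ge0 ltW// hlt.
  rewrite PE// /k maxE ?ltW// sqrtrM// sqrtrM ?(ltW Gs)// /q /weight !invfM -/lambda.
  by ring.
have mq : measurable_fun `]0, m[ q by exact: (travel_measurable hp).
have q0 s : 0 < s < m -> 0 <= q s.
  by move=> /andP[s0 _]; exact: (travel_integrand_ge0 hp).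
have s2 : 0 < Num.sqrt 2 :> R by rewrite sqrtr_gt0.
(* This is the mass on one half-line: [T(m) / sqrt 2] with [T(m) = rho / sqrt 2]. *)
have kint : (\int[mu]_(s in `]0%R, m[) (k s / Num.sqrt (2 * P s))%:E =
    (rho / 2)%:E)%E.
  transitivity (\int[mu]_(s in `]0%R, m[) ((Num.sqrt 2)^-1 * q s)%:E)%E.
    by apply: eq_integral => s; rewrite inE/= in_itv/= => sI; rewrite kqE.
  rewrite integral_oo_scale// ?invr_ge0 ?ltW//.
  rewrite [X in (_ * X)%E]Tm -EFinM; congr EFin.
  have E2 : Num.sqrt 2 ^+ 2 = 2 :> R by rewrite sqr_sqrtr.
  have H (s : R) : 0 < s -> s ^+ 2 = 2 -> s^-1 * (rho / s) = rho / 2.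
    by move=> s0 <-; field; rewrite gt_eqF.
  exact: H.
have ki : mu.-integrable `]0, m[ (EFin \o (fun s => k s / Num.sqrt (2 * P s))).
  have qi : mu.-integrable `]0, m[ (EFin \o q).
    apply/integrableP; split; first exact/measurable_EFinP.
    apply: (@le_lt_trans _ _ (rho / Num.sqrt 2)%:E); last exact: ltry.
    rewrite -Tm le_eqVlt; apply/orP; left; apply/eqP; apply: eq_integral => s.
    by rewrite inE/= in_itv/= => sI; rewrite ger0_norm// q0.
  apply: eq_integrable (integrable_scale (Num.sqrt 2)^-1 qi) => //.
  by move=> s; rewrite inE/= in_itv/= => sI; rewrite kqE.
have [] := @ground_state R P p k m m_gt0 cP cp (continuous_clamp cK) _ _ _ _ Ppos dP _ ki.
- by rewrite /P maxE// F0 G0 mulr0 subrr.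
- by rewrite PE// subrr mulr0.
- by rewrite /p maxE// f0 g0 mulr0 subrr.
- by rewrite /k maxE// K0.
- by move=> s s0; rewrite /k maxE ?ltW// Kpos.
move=> u [C2u [u0 [u'' [mass [u'L2 [uN [uy uNy]]]]]]].
exists lambda, u; split=> //; split=> //; split.
  by move=> x; rewrite u'' /p maxE//; ring.
split; last by [].
transitivity (\int[mu]_x (k (u x))%:E)%E.
  by apply: eq_integral => x _; rewrite /k maxE.
by rewrite mass kint -EFinM; congr EFin; field.
Unshelve. all: by end_near. Qed.
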